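(* Let $X$ be a subspace of an ordinal (with the order topology). Then the following are equivalent: (1) no subspace of $X$ is homeomorphic to a stationary subset of a regular uncountable cardinal, and $X$ is character-homogeneous at all non-isolated points, i.e. $\chi(x,X)=\chi(y,X)$ for all non-isolated points $x,y\in X$; (2) $X$ has a $\tau$-discrete basis of clopen sets, where $\tau$ is the $P$-number of $X$; (3) $X^n$ is suborderable (a GO-space) for every positive integer $n$.
   Context: The $P$-number of a space $X$ is $|X|$ if $X$ is discrete; otherwise it is the largest cardinal $\tau$ such that the intersection of any family of fewer than $\tau$ open subsets of $X$ is open. A family of subsets of $X$ is discrete if every point of $X$ has a neighborhood meeting at most one member of the family. A $\tau$-discrete basis of clopen sets is a base for the topology of the form $\bigcup_{\alpha<\tau}\mathcal B_\alpha$ consisting of clopen sets, with each $\mathcal B_\alpha$ a discrete family. $\chi(x,X)$ denotes the character of $X$ at $x$. A space is suborderable (a GO-space) if it is homeomorphic to a subspace of a linearly ordered topological space. *)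

(* Defs.v *)
From HB Require Import structures.
From mathcomp Require Import all_boot all_order all_algebra.
From mathcomp Require Import all_classical all_reals.
From mathcomp Require Import topology_theory.topology function_spaces.

Set Implicit Arguments.
Unset Strict Implicit.
Unset Printing Implicit Defensive.

Import Order.TTheory.
Local Open Scope classical_set_scope.
Local Open Scope card_scope.

Definition go_card_lt {T U : Type} (A : set T) (B : set U) : Prop :=
  (A #<= B) /\ ~ (B #<= A).

Definition go_homeomorphic (S T : topologicalType) : Prop :=
  exists (f : S -> T) (g : T -> S),
    cancel f g /\ cancel g f /\ continuous f /\ continuous g.

(** a well-ordered linearly ordered topological space, i.e. (up to
    order-isomorphism) an ordinal with its order topology *)
Definition go_well_ordered {d} (W : orderTopologicalType d) : Prop :=
  well_founded (fun x y : W => (x < y)%O).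

Definition go_isolated {T : topologicalType} (x : T) : Prop := open [set x].

Definition go_local_base {T : topologicalType} (x : T) (B : set (set T)) : Prop :=
  (forall U, B U -> open U /\ U x) /\
  (forall V, nbhs x V -> exists2 U, B U & U `<=` V).

(** chi(x,T) <= chi(y,T) : the character is the least cardinality of a
    local base *)
Definition go_character_le {T : topologicalType} (x y : T) : Prop :=
  forall By, go_local_base y By -> exists Bx, go_local_base x Bx /\ (Bx #<= By).

Definition go_character_eq {T : topologicalType} (x y : T) : Prop :=
  go_character_le x y /\ go_character_le y x.

Definition go_discrete_space (T : topologicalType) : Prop :=
  forall A : set T, open A.

Definition go_small_intersections_open (T : topologicalType) (I : Type) : Prop :=
  forall F : set (set T), go_card_lt F [set: I] ->
    (forall U, F U -> open U) -> open (\bigcap_(U in F) U).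

Definition go_Pnumber_is (T : topologicalType) (I : Type) : Prop :=
  (go_discrete_space T -> [set: I] #= [set: T]) /\
  (~ go_discrete_space T ->
     go_small_intersections_open T I /\
     (forall J : Type, go_small_intersections_open T J -> [set: J] #<= [set: I])).

Definition go_discrete_family {T : topologicalType} (F : set (set T)) : Prop :=
  forall x : T, exists2 U, nbhs x U &
    forall A B, F A -> F B -> U `&` A !=set0 -> U `&` B !=set0 -> A = B.

Definition go_is_base {T : topologicalType} (B : set (set T)) : Prop :=
  (forall U, B U -> open U) /\
  (forall V, open V -> forall x, V x -> exists2 U, B U & U x /\ U `<=` V).

Definition go_discrete_clopen_base (T : topologicalType) (I : Type) : Prop :=
  exists Bs : I -> set (set T),
    (forall i, go_discrete_family (Bs i)) /\
    (forall i U, Bs i U -> open U /\ closed U) /\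
    go_is_base (\bigcup_(i in [set: I]) Bs i).

Definition go_regular_uncountable_cardinal {d} (K : orderTopologicalType d) : Prop :=
  go_well_ordered K /\
  (forall k : K, go_card_lt [set y : K | (y < k)%O] [set: K]) /\
  ~ countable [set: K] /\
  (forall C : set K, (forall k, exists2 c, C c & (k <= c)%O) -> [set: K] #<= C).

Definition go_club {d} (K : orderTopologicalType d) (C : set K) : Prop :=
  closed C /\ (forall k, exists2 c, C c & (k <= c)%O).

Definition go_stationary {d} (K : orderTopologicalType d) (S : set K) : Prop :=
  forall C, go_club C -> S `&` C !=set0.

Definition go_suborderable (T : topologicalType) : Prop :=
  exists d (L : orderTopologicalType d) (A : set L),
    go_homeomorphic T (set_type A).

Definition go_power (T : topologicalType) (n : nat) : topologicalType :=
  prod_topology (fun _ : 'I_n => T).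

(* Main.v *)
(* Call a family of equivalence relations, decreasing along a well-ordered index set,
   with open classes forming a base, a non-archimedean structure.

   (1) => (2).  Let I be a local base of least cardinality at a non-isolated point, with
   an initial well order.  By induction on w, the points of X below w carry a
   non-archimedean structure indexed by I.  If M is an initial segment without maximum,
   either some cofinal C in M has no limit point in X, and then w |-> least element of C
   above w is locally constant on X, cutting X into bounded clopen pieces; or thinning a
   cofinal set of least cardinality and closing it gives a copy of a regular cardinal
   (uncountable, since omega-sequences have no limit points) in which X is stationary.
   A non-isolated point p is then added by using, as its class of index i, a tail of
   pieces; here the character of p must equal that of the point defining I.  The
   classes give (2), and I computes the P-number.

   (2) => (3).  Since intersections of fewer than tau open sets are open, agreement on
   the first i discrete clopen families is a non-archimedean structure.  It passes to
   finite powers, and a space with such a structure embeds in a lexicographic order.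

   (3) => (1).  GO-spaces are completely normal, and so is X^2.  If the characters of x and
   y differ, {(a,y) : a < x} and {(x,b) : b < y} cannot be separated.  If S is a
   stationary set in X with non-isolated point alpha, {(l,a) : l non-isolated, a < alpha}
   and {(s,alpha) : s isolated} cannot be separated in S^2: by regularity one a serves
   cofinally many s, and these accumulate at some l in S. *)

Require Import Defs.
From HB Require Import structures.
From Stdlib Require Inverse_Image.
From mathcomp Require wochoice.
From mathcomp Require Import all_boot all_order all_algebra.
From mathcomp Require Import all_classical all_reals.
From mathcomp Require Import topology_theory.topology function_spaces.

Set Implicit Arguments.
Unset Strict Implicit.
Unset Printing Implicit Defensive.

Import Order.TTheory.
Local Open Scope classical_set_scope.
Local Open Scope card_scope.

(** * Cardinals and well orders *)

Lemma card_le_injE {T U : Type} (A : set T) (B : set U) : A #<= B ->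
  exists f : set_type A -> U, (forall a, B (f a)) /\ injective f.
Proof.
move=> /card_leP[f]; exists (fun a => val (f a)); split.
  by move=> a; apply: set_mem; exact: valP.
by move=> a b /val_inj; apply: inj; rewrite inE.
Qed.

Lemma card_le_injI {T U : Type} (A : set T) (B : set U) (f : T -> U) :
  (forall a, A a -> B (f a)) ->
  (forall a b, A a -> A b -> f a = f b -> a = b) -> A #<= B.
Proof.
move=> fAB finj; apply: (@card_le_trans _ _ _ (f @` A)).
  have /card_eqPle[] // : f @` A #= A.
  by apply: inj_card_eq => a b /set_mem Aa /set_mem Ab; exact: finj.
by apply: subset_card_le => _ [a Aa <-]; exact: fAB.
Qed.

Lemma card_le_setT_sub {T U : Type} (A : set T) (B : set U) :
  ([set: set_type A] #<= B) = (A #<= B).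
Proof. by apply: card_le_eql; exact: card_setT. Qed.

(* Hoenig: take a maximal set R of choice functions with injective projections;
   by maximality some projection of R is onto, and that factor embeds in all others. *)
Lemma card_minimal_type (J : Type) (A : J -> Type) (j0 : J) :
  exists j, forall k, [set: A j] #<= [set: A k].
Proof.
pose P (R : set (forall j, A j)) :=
  forall f g, R f -> R g -> forall j, f j = g j -> f = g.
have [F FP Ftot|R [PR Rmax]] := @Zorn_bigcup _ P.
  move=> f g [X FX Xf] [Y FY Yg]; have [XY|YX] := Ftot _ _ FX FY.
    by apply: (FP _ FY) => //; exact: XY.
  by apply: (FP _ FX) => //; exact: YX.
have [j jP] : exists j, forall a, exists2 f, R f & f j = a.
  apply: contrapT => /forallNP H.
  have {}H j : exists a, forall f, R f -> f j <> a.
    have /existsNP[a /forall2NP Ha] := H j.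
    by exists a => f Rf; case: (Ha f).
  have [h hP] : {h : forall j, A j & forall j f, R f -> f j <> h j}.
    by exists (fun j => projT1 (cid (H j))) => j; exact: (projT2 (cid (H j))).
  apply: (Rmax (R `|` [set h])).
    split; first by move=> f Rf; left.
    by move=> /(_ h (or_intror erefl)) /(hP j0).
  move=> f g [Rf|->] [Rg|->] // j; first exact: PR.
    by move=> /(hP j _ Rf).
  by move=> /esym /(hP j _ Rg).
exists j => k.
pose s a := projT1 (cid2 (jP a)).
have sP a : R (s a) /\ s a j = a by rewrite /s; case: cid2.
apply: (@card_le_injI _ _ _ _ (fun a => s a k)) => // a b _ _ ab.
have [Ra Ea] := sP a; have [Rb Eb] := sP b.
by move: Ea; rewrite (PR _ _ Ra Rb _ ab) Eb.
Qed.

Lemma card_minimal {T : Type} (P : set (set T)) : P !=set0 ->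
  exists2 A, P A & forall B, P B -> A #<= B.
Proof.
move=> [A0 PA0].
have [[A PA] Amin] :=
  @card_minimal_type {A : set T | P A} (fun A => set_type (projT1 A))
    (exist _ A0 PA0).
exists A => // B PB; have := Amin (exist _ B PB).
by rewrite card_le_setT_sub (card_le_eqr (card_setT _)).
Qed.

(** Comparability is the case of a family of two types: the minimal one embeds in the other. *)
Lemma card_le_total (T U : Type) : [set: T] #<= [set: U] \/ [set: U] #<= [set: T].
Proof.
have [[] H] := @card_minimal_type bool (fun b => if b then T else U) true.
  by left; exact: (H false).
by right; exact: (H true).
Qed.

Definition strict_well_order (I : Type) (R : I -> I -> Prop) :=
  [/\ (forall i j k, R i j -> R j k -> R i k),
      (forall i j, [\/ R i j, i = j | R j i]) & well_founded R].

Lemma wf_least (I : Type) (R : I -> I -> Prop) (P : set I) :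
  well_founded R -> P !=set0 -> exists2 m, P m & forall y, R y m -> ~ P y.
Proof.
move=> Rwf [x Px]; elim/(well_founded_ind Rwf): x Px => x IH Px.
have [[y Ryx Py]|H] := pselect (exists2 y, R y x & P y); first exact: IH Ryx Py.
by exists x => // y Ryx Py; apply: H; exists y.
Qed.

Lemma wf_irrefl (I : Type) (R : I -> I -> Prop) i : well_founded R -> ~ R i i.
Proof. by move=> Rwf; elim/(well_founded_ind Rwf): i => i IH Rii; exact: (IH i Rii Rii). Qed.

Lemma exists_strict_well_order (I : Type) :
  exists R : I -> I -> Prop, strict_well_order R.
Proof.
elim/Peq: I => I; have [Q Qwo] := wochoice.well_ordering_principle I.
have Qmin (P : set I) : P !=set0 -> exists2 m, P m & forall y, P y -> Q m y.
  move=> [x Px]; have [|m [[Pm mP] _]] := Qwo [pred x | `[< P x >]].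
    by exists x; rewrite inE.
  exists m; first by move: Pm; rewrite inE.
  by move=> y Py; apply: mP; rewrite inE.
have Qrefl x : Q x x.
  have [|m mE mP] := Qmin [set x]; first by exists x.
  by rewrite -{1}mE; apply: mP.
have Qtot x y : Q x y \/ Q y x.
  have [|m [->|->] mP] := Qmin [set x; y]; first by exists x; left.
    by left; apply: mP; right.
  by right; apply: mP; left.
(* Antisymmetry comes from uniqueness of minima: if both relations hold, [x] and [y] are both minima
   of the pair. *)
have Qanti x y : Q x y -> Q y x -> x = y.
  move=> xy yx; have [|m [_ mU]] := Qwo [pred z | (z == x) || (z == y)].
    by exists x; rewrite inE /= eqxx.
  have -> : x = m.
    apply/esym/mU; split; first by rewrite inE /= eqxx.
    by move=> z; rewrite inE /= => /orP[] /eqP ->.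
  apply/mU; split; first by rewrite inE /= eqxx orbT.
  by move=> z; rewrite inE /= => /orP[] /eqP ->.
have Qtrans x y z : Q x y -> Q y z -> Q x z.
  move=> xy yz; have [|m mm mP] := Qmin [set x; y; z]; first by exists x; do 2 left.
  case: mm => [[/= mE|/= mE]|/= mE]; subst m.
  - by apply: mP; right.
  - by have -> // : x = y by apply: Qanti => //; apply: mP; left; left.
  - have <- // : y = z by apply: Qanti => //; apply: mP; left; right.
exists (fun x y => Q x y /\ x <> y); split.
- move=> x y z [xy nxy] [yz nyz]; split; first exact: Qtrans yz.
  by move=> xz; subst z; apply: nxy; exact: Qanti.
- move=> x y; have [->|/eqP xy] := eqVneq x y; first exact: Or32.
  have [Qxy|Qyx] := Qtot x y; first exact: Or31.
  by apply: Or33; split => // /esym.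
- move=> x; apply: contrapT => Nx.
  have [|m Nm mP] := Qmin [set x | ~ Acc (fun x y => Q x y /\ x <> y) x].
    by exists x.
  apply: Nm; constructor => y [ym nym]; apply: contrapT => /mP my.
  by apply: nym; exact: Qanti.
Qed.

(** If some initial segment is as large as [I], take the least [i] bounding such a segment and pull
    the order back along an injection of [I] below [i]. Segments of the new order embed in segments
    bounded before [i], which are too small. *)
Lemma exists_initial_well_order (I : Type) :
  exists2 R : I -> I -> Prop, strict_well_order R &
    forall i, ~ ([set: I] #<= [set j | R j i]).
Proof.
have [R [Rtr Rtri Rwf]] := exists_strict_well_order I.
have [H|/existsNP[i0 /contrapT Hi0]] :=
  pselect (forall i, ~ ([set: I] #<= [set j | R j i])); first by exists R.
have [|i /= Hi imin] :=
  @wf_least _ _ [set i | [set: I] #<= [set j | R j i]] Rwf; first by exists i0.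
have [f [fR finj]] := card_le_injE Hi.
pose phi j := f (exist _ j (in_setT j)).
have phi_inj : injective phi by move=> a b /finj /(congr1 val).
exists (fun a b => R (phi a) (phi b)).
  split.
  - by move=> a b c; exact: Rtr.
  - move=> a b; have [?|/phi_inj ->|?] := Rtri (phi a) (phi b);
      [exact: Or31|exact: Or32|exact: Or33].
  - exact: (Inverse_Image.wf_inverse_image _ _ R phi Rwf).
move=> a H; apply: (imin (phi a)); first exact: fR.
apply: (card_le_trans H); apply: (@card_le_injI _ _ _ _ phi) => //.
by move=> x y _ _ /phi_inj.
Qed.

(** * Embeddings and neighbourhoods *)

(** The last clause says that [S] carries the topology induced by [e], in a form that composes
    without mentioning the image as a space. *)
Definition embedding {S T : topologicalType} (e : S -> T) : Prop :=
  [/\ injective e, continuous e &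
      forall x V, nbhs x V ->
        exists2 U, nbhs (e x) U & forall y, U (e y) -> V y].

Lemma nbhs_set_type {T : topologicalType} (A : set T) (x : set_type A) V :
  nbhs x V <-> exists2 U, nbhs (val x) U & forall y : set_type A, U (val y) -> V y.
Proof.
split.
  case=> /= B [[C oC <-] Cx] CV; exists C; first exact: open_nbhs_nbhs.
  exact: CV.
move=> [U Ux UV]; apply: filterS UV _.
exact: (@initial_continuous _ T (set_val : set_type A -> T)).
Qed.

Lemma embedding_val {T : topologicalType} (A : set T) :
  embedding (val : set_type A -> T).
Proof.
split; first exact: val_inj.
  by move=> x U Ux; apply/nbhs_set_type; exists U.
by move=> x V /nbhs_set_type.
Qed.

Lemma embedding_comp {S T U : topologicalType} (f : S -> T) (g : T -> U) :
  embedding f -> embedding g -> embedding (g \o f).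
Proof.
move=> [fi fc fo] [gi gc go]; split.
- by move=> x y /gi /fi.
- by move=> x; apply: continuous_comp; [exact: fc|exact: gc].
- move=> x V /fo[W Wx WV]; have [Z Zx ZW] := go _ _ Wx.
  by exists Z => // y /ZW /WV.
Qed.

Lemma embedding_cancel {S T : topologicalType} (f : S -> T) (g : T -> S) :
  cancel f g -> continuous f -> continuous g -> embedding f.
Proof.
move=> fK fc gc; split => //; first exact: can_inj fK.
move=> x V Vx; exists (g @^-1` V); last by move=> y /=; rewrite fK.
by apply: gc; rewrite fK.
Qed.

Lemma embedding_map_pair {S T S' T' : topologicalType} (f : S -> T) (g : S' -> T') :
  embedding f -> embedding g -> embedding (fun p : S * S' => (f p.1, g p.2)).
Proof.
move=> [fi fc fo] [gi gc go]; split.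
- by move=> [x x'] [y y'] /= [/fi -> /gi ->].
- move=> [x x'] U [[A B] /= [Ax Bx] ABU]; exists (f @^-1` A, g @^-1` B) => /=.
    by split; [exact: fc|exact: gc].
  by move=> [y y'] /= [Ay By]; exact: ABU.
- move=> [x x'] U [[A B] /= [Ax Bx] ABU].
  have [A' A'x A'A] := fo _ _ Ax; have [B' B'x B'B] := go _ _ Bx.
  exists (A' `*` B'); first by exists (A', B').
  by move=> [y y'] /= [/A'A Ay /B'B By]; exact: ABU.
Qed.

Lemma embedding_homeomorphic {S T : topologicalType} (e : S -> T) :
  embedding e -> go_homeomorphic S (set_type (range e)).
Proof.
move=> [ei ec eo].
have er x : e x \in range e by apply/mem_set; exists x.
have rP (y : set_type (range e)) : exists x, e x = val y.
  by have /set_mem[x _ <-] := valP y; exists x.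
pose g y := projT1 (cid (rP y)).
have gP y : e (g y) = val y by rewrite /g; case: cid.
exists (fun x => exist _ (e x) (er x)), g; split; last split; last split.
- by move=> x; apply: ei; rewrite gP.
- by move=> y; apply: val_inj; rewrite /= gP.
- move=> x V /nbhs_set_type[U Ux UV]; suff: nbhs x [set y | V (exist _ (e y) (er y))] by [].
  have : nbhs x (e @^-1` U) := ec _ _ Ux.
  by apply: filterS => y; exact: (UV (exist _ (e y) (er y))).
- move=> y V /eo[U Ux UV]; apply/nbhs_set_type; exists U; first by rewrite -gP.
  by move=> z Uz; apply: UV; rewrite gP.
Qed.

Lemma nbhs_power {T : topologicalType} n (t : go_power T n) U :
  nbhs t U <-> exists2 V : 'I_n -> set T, (forall k, nbhs (t k) (V k)) &
    forall s : go_power T n, (forall k, V k (s k)) -> U s.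
Proof.
(* [G] is the filter generated by boxes around [t]. It converges to [t] in every coordinate
   topology, hence in their supremum, the product topology. *)
pose G : set_system (go_power T n) := [set U |
  exists2 V : 'I_n -> set T, (forall k, nbhs (t k) (V k)) &
    forall s : go_power T n, (forall k, V k (s k)) -> U s].
have FG : Filter G.
  split.
  - by exists (fun=> setT) => // k; exact: filterT.
  - move=> A B [V Vt VA] [W Wt WB]; exists (fun k => V k `&` W k).
      by move=> k; exact: filterI.
    by move=> s VWs; split; [apply: VA => k; case: (VWs k)|
                             apply: WB => k; case: (VWs k)].
  - by move=> A B AB [V Vt VA]; exists V => // s /VA /AB.
have Gt : G --> t.
  apply/cvg_sup => k A [B [[C oC <-] Ct] CA].
  exists (fun i => if i == k then C else setT).
    move=> i; case: eqVneq => [->|_]; last exact: filterT.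
    exact: open_nbhs_nbhs.
  by move=> s /(_ k); rewrite eqxx => Cs; exact: CA.
split; first exact: Gt.
move=> [V Vt VU]; apply: filterS VU _.
have pc k : nbhs t [set s : go_power T n | V k (s k)].
  exact: (@proj_continuous _ (fun=> T) k t (V k) (Vt k)).
have := @filter_forall _ _ (fun k (s : go_power T n) => V k (s k)) (nbhs t) _ pc.
by apply.
Qed.

(** Passes from the power of exponent 2 in condition (3) to pairs, in which the sets that cannot be
    separated are written. *)
Lemma embedding_pair_power {T : topologicalType} :
  embedding (fun p : T * T => (fun k => if k == ord0 then p.1 else p.2) : go_power T 2).
Proof.
split.
- move=> [x x'] [y y'] /= E.
  by have /= -> := congr1 (@^~ ord0) E; have /= -> := congr1 (@^~ ord_max) E.
- move=> [x x'] U /nbhs_power[V Vx VU].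
  exists (V ord0, V ord_max) => /=.
    by split; [exact: (Vx ord0)|exact: (Vx ord_max)].
  move=> [y y'] /= [Vy Vy']; apply: VU => k; case: eqVneq => [->//|k0].
  by have -> // : k = ord_max; apply/val_inj; case: k k0 => -[|[]].
- move=> [x x'] U [[A B] /= [Ax Bx] ABU].
  exists [set s : go_power T 2 | A (s ord0) /\ B (s ord_max)].
    apply/nbhs_power; exists (fun k => if k == ord0 then A else B).
      by move=> k; case: eqVneq.
    by move=> s sP; have := sP ord0; have := sP ord_max.
  by move=> [y y'] /= [? ?]; exact: ABU.
Qed.

(** Basic neighbourhoods are written as intersections of two rays, either of which may be the whole
    line; this covers end points uniformly. *)
Lemma order_nbhsI {d} {L : orderTopologicalType d} (x : L) (P Q U : set L) :
  (P = setT \/ exists2 a, (a < x)%O & P = [set y | (a < y)%O]) ->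
  (Q = setT \/ exists2 b, (x < b)%O & Q = [set y | (y < b)%O]) ->
  P `&` Q `<=` U -> nbhs x U.
Proof.
move=> HP HQ /filterS; apply; apply: filterI.
  case: HP => [->|[a ax ->]]; first exact: filterT.
  have := @rray_open _ L a; rewrite set_itvE => o.
  exact: open_nbhs_nbhs.
case: HQ => [->|[a ax ->]]; first exact: filterT.
have := @lray_open _ L a; rewrite set_itvE => o.
exact: open_nbhs_nbhs.
Qed.

Lemma order_nbhsE {d} {L : orderTopologicalType d} (x : L) (U : set L) :
  nbhs x U -> exists P Q : set L,
  [/\ (P = setT \/ exists2 a, (a < x)%O & P = [set y | (a < y)%O]),
      (Q = setT \/ exists2 b, (x < b)%O & Q = [set y | (y < b)%O]) &
      P `&` Q `<=` U].
Proof.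
rewrite itv_nbhsE => -[[l r] [/= + xi iU]].
case: l xi iU => [[] a|[]] //; case: r => [[] b|[]] //=;
  rewrite /itv_open_ends //= ?in_itv /= => xi iU _.
- exists [set y | (a < y)%O], [set y | (y < b)%O]; case/andP: xi => ax xb.
  split; [by right; exists a|by right; exists b|].
  by move=> y /= [ay yb]; apply: iU; rewrite /= in_itv /= ay yb.
- exists [set y | (a < y)%O], setT; rewrite andbT in xi.
  split; [by right; exists a|by left|].
  by move=> y /= [ay _]; apply: iU; rewrite /= in_itv /= ay.
- exists setT, [set y | (y < b)%O].
  split; [by left|by right; exists b|].
  by move=> y /= [_ ay]; apply: iU; rewrite /= in_itv /= ay.
- exists setT, setT; split; [by left|by left|].
  by move=> y _; apply: iU; rewrite /= in_itv.
Qed.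

(** * Non-archimedean structures *)

Record strict_total_order (M : Type) := StrictTotalOrder {
  sto_lt : M -> M -> Prop ;
  sto_irrefl : forall x, ~ sto_lt x x ;
  sto_trans : forall x y z, sto_lt x y -> sto_lt y z -> sto_lt x z ;
  sto_total : forall x y, [\/ sto_lt x y, x = y | sto_lt y x] }.

(** A synonym of [M] that mentions [N], so that order instances can be attached to it for each
    [N]. *)
Definition ordered_by (M : Type) (N : strict_total_order M) : Type := M.

Section OrderedBy.
Variables (M : Type) (N : strict_total_order M).
Local Notation oM := (ordered_by N).

Let le (x y : oM) : bool := `[< x = y \/ sto_lt N x y >].
Let lt (x y : oM) : bool := `[< sto_lt N x y >].

Let lt_def' x y : lt x y = (`[< y <> x >] && le x y).
Proof.
apply/asboolP/andP => [xy|[/asboolP yx /asboolP[xy|//]]].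
  split; apply/asboolP; last by right.
  by move=> yx; subst y; exact: (sto_irrefl xy).
by case: yx.
Qed.

Let le_refl : reflexive le. Proof. by move=> x; apply/asboolP; left. Qed.

Let le_anti : antisymmetric le.
Proof.
move=> x y /andP[/asboolP[//|xy] /asboolP[//|yx]].
by case: (sto_irrefl (sto_trans xy yx)).
Qed.

Let le_trans : transitive le.
Proof.
move=> y x z /asboolP[->//|xy] /asboolP[<-|yz]; apply/asboolP; right => //.
exact: sto_trans yz.
Qed.

Let le_total : total le.
Proof.
move=> x y; apply/orP; have [xy|->|yx] := sto_total N x y.
- by left; apply/asboolP; right.
- by left; apply/asboolP; left.
- by right; apply/asboolP; right.
Qed.

HB.instance Definition _ := gen_eqMixin oM.
HB.instance Definition _ := gen_choiceMixin oM.

Let lt_def x y : lt x y = (y != x) && le x y.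
Proof.
by rewrite lt_def'; congr (_ && _); apply/idP/idP => [/asboolP /eqP //|/eqP ?];
exact/asboolP.
Qed.

HB.instance Definition _ :=
  Order.isPOrder.Build Order.default_display oM lt_def le_refl le_anti le_trans.
HB.instance Definition _ :=
  Order.POrder_isTotal.Build Order.default_display oM le_total.

Lemma ordered_by_ltE (x y : order_topology oM) : (x < y)%O = `[< sto_lt N x y >].
Proof. by []. Qed.

End OrderedBy.

(** * Lexicographic orders and powers of non-archimedean structures *)

Section Lexicographic.
Variables (I M : Type) (R : I -> I -> Prop) (RW : strict_well_order R).
Variable N : strict_total_order M.

Definition lexi_lt (f g : I -> M) : Prop :=
  exists2 i, (forall j, R j i -> f j = g j) & sto_lt N (f i) (g i).

Lemma lexi_irrefl f : ~ lexi_lt f f.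
Proof. by move=> [i _]; exact: sto_irrefl. Qed.

Lemma lexi_trans f g h : lexi_lt f g -> lexi_lt g h -> lexi_lt f h.
Proof.
have [Rtr Rtri _] := RW.
move=> [i fg fgi] [j gh ghj]; have [ij|ij|ji] := Rtri i j.
- exists i; last by rewrite -gh.
  by move=> k ki; rewrite fg // gh //; exact: Rtr ij.
- subst j; exists i; last exact: sto_trans ghj.
  by move=> k ki; rewrite fg // gh.
- exists j; last by rewrite fg.
  by move=> k kj; rewrite fg ?gh //; exact: Rtr ji.
Qed.

(** Well-foundedness supplies the first index at which the two functions differ. *)
Lemma lexi_total f g : [\/ lexi_lt f g, f = g | lexi_lt g f].
Proof.
have [_ _ Rwf] := RW.
have [->|fg] := pselect (f = g); first exact: Or32.
have [|i /= fgi imin] := @wf_least _ _ [set i | f i <> g i] Rwf.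
  apply: contrapT => H; apply: fg; apply/funext => i; apply: contrapT => fgi.
  by apply: H; exists i.
have E j : R j i -> f j = g j by move=> /imin /contrapT.
have [lt|//|gt] := sto_total N (f i) (g i); first by apply: Or31; exists i.
by apply: Or33; exists i => // j /E.
Qed.

Definition lexi_order :=
  StrictTotalOrder lexi_irrefl lexi_trans lexi_total.

End Lexicographic.

(* The equivalence relations decrease along [R]; neighbourhoods are taken in [T], and
   the guards [A y] make openness and base relative to the subspace [A]. *)
Definition nonarchimedean {T : topologicalType} (A : set T) (I : Type)
    (R : I -> I -> Prop) (E : I -> T -> T -> Prop) : Prop :=
  [/\ [/\ (forall i x, A x -> E i x x),
          (forall i x y, E i x y -> E i y x) &
          (forall i x y z, E i x y -> E i y z -> E i x z)],
      (forall i j x y, R i j -> E j x y -> E i x y),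
      (forall i x, A x -> \forall y \near x, A y -> E i x y) &
      (forall x U, A x -> nbhs x U ->
         exists i, forall y, A y -> E i x y -> U y)].

Lemma nonarchimedean_power {T : topologicalType} (I : Type) (R : I -> I -> Prop)
    (E : I -> T -> T -> Prop) n : strict_well_order R -> (0 < n)%N ->
  nonarchimedean [set: T] R E ->
  nonarchimedean [set: go_power T n] R
    (fun i s t => forall k : 'I_n, E i (s k) (t k)).
Proof.
move=> [Rtr Rtri _] n0 [[Er Es Et] Em Eo Eb]; split; first split.
- by move=> i x _ k; exact: Er.
- by move=> i x y xy k; exact: Es.
- by move=> i x y z xy yz k; exact: Et (xy k) (yz k).
- by move=> i j x y ij xy k; exact: Em ij (xy k).
- move=> i x _; apply/nbhs_power; exists (fun k => [set y | E i (x k) y]).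
    by move=> k; have := Eo i (x k) Logic.I; apply: filterS => y; exact.
  by move=> s sP _ k; exact: sP.
- move=> x U _ /nbhs_power[V Vx VU].
  have /choice[h hP] : forall k, exists i, forall y, E i (x k) y -> V k y.
    by move=> k; have [i iP] := Eb (x k) (V k) Logic.I (Vx k); exists i => y; exact: iP.
  (* An upper bound of the finitely many indices [h k]; since [0 < n], coordinate zero gives a
     starting value. *)
  have [i iP] : exists i, forall k, R (h k) i \/ h k = i.
    have [i iP] : exists i, forall k, k \in enum 'I_n -> R (h k) i \/ h k = i.
      elim: (enum 'I_n) => [|k s [i iP]]; first by exists (h (Ordinal n0)).
      have [hi|hi|ih] := Rtri (h k) i.
      - exists i => // k'; rewrite inE => /orP[/eqP ->|/iP//]; by left.
      - exists i => // k'; rewrite inE => /orP[/eqP ->|/iP//]; by right.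
      - exists (h k) => // k'; rewrite inE => /orP[/eqP ->|/iP[k'i|->]]; [by right| |by left].
        by left; exact: Rtr ih.
    by exists i => k; apply: iP; rewrite mem_enum.
  exists i => y _ xy; apply: VU => k; apply: hP => //.
  by have [hk|->] := iP k; [exact: Em hk (xy k)|exact: xy].
Qed.

Lemma strict_well_order_total (C : Type) (S : C -> C -> Prop) :
  strict_well_order S ->
  {N : strict_total_order C | sto_lt N = S}.
Proof.
move=> [Str Stri Swf].
by exists (@StrictTotalOrder C S (fun i => @wf_irrefl _ _ i Swf) Str Stri).
Qed.

Section LexicographicPair.
Variables (C : Type) (N : strict_total_order C).

Definition pair_lt (x y : C * nat) : Prop :=
  sto_lt N x.1 y.1 \/ x.1 = y.1 /\ (x.2 < y.2)%N.

Lemma pair_irrefl x : ~ pair_lt x x.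
Proof. by move=> [xx|[_]]; [exact: (sto_irrefl xx)|rewrite ltnn]. Qed.

Lemma pair_trans x y z : pair_lt x y -> pair_lt y z -> pair_lt x z.
Proof.
move: x y z => [a i] [b j] [c k]; rewrite /pair_lt /=.
move=> [ab|[<- ij]] [bc|[<- jk]]; [left|by left|by left|right].
  exact: sto_trans bc.
by split => //; exact: ltn_trans jk.
Qed.

Lemma pair_total x y : [\/ pair_lt x y, x = y | pair_lt y x].
Proof.
move: x y => [a i] [b j]; rewrite /pair_lt /=.
have [ab|->|ba] := sto_total N a b; [by apply: Or31; left| |by apply: Or33; left].
by case: (ltngtP i j) => [ij|ji|->]; [apply: Or31|apply: Or33|apply: Or32]; auto.
Qed.

Definition pair_order := StrictTotalOrder pair_irrefl pair_trans pair_total.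

End LexicographicPair.

(* The classes of [x] give a branch [i |-> class of x]; branches are ordered
   lexicographically, and each coordinate carries extra values just below and just
   above the one used, so that every class is cut out by an open interval. *)
Lemma nonarchimedean_suborderable {T : topologicalType} (I : Type)
    (R : I -> I -> Prop) (E : I -> T -> T -> Prop) :
  (forall x y : T, x <> y -> exists2 U, nbhs x U & ~ U y) ->
  strict_well_order R -> nonarchimedean [set: T] R E -> go_suborderable T.
Proof.
move=> T1 RW [[Er Es Et] Em Eo Eb]; have [Rtr Rtri Rwf] := RW.
have [S SW] := exists_strict_well_order (set T).
pose N := pair_order (projT1 (strict_well_order_total SW)).
pose L := order_topology (ordered_by (lexi_order RW N)).
pose cl i x : set T := [set y | E i x y].
have clE i x y : cl i x = cl i y <-> E i x y.
  split=> [/(congr1 (@^~ y)) H|xy].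
    by have : cl i y y by [exact: Er]; rewrite -H.
  by apply/predeqP => z; split; [apply: Et; exact: Es|exact: Et].
have ltE (f g : L) : (f < g)%O <-> lexi_lt R N f g.
  by rewrite ordered_by_ltE; split => /asboolP.
pose e (x : T) : L := fun i => (cl i x, 1%N).
exists Order.default_display, L, (range e); apply: embedding_homeomorphic; split.
- move=> x y xy; apply: contrapT => /T1[U /(Eb _ _ Logic.I)[i iU]]; apply.
  by apply: iU => //; apply/clE; have := congr1 (fun f : L => (f i).1) xy.
- move=> x U /order_nbhsE[P [Q [HP HQ PQU]]].
  suff [Px Qx] : nbhs x (e @^-1` P) /\ nbhs x (e @^-1` Q).
    suff : nbhs x (e @^-1` U) by [].
    by apply: (filterS _ (filterI Px Qx)) => y; exact: PQU.
  have eE i y j : (R j i \/ j = i) -> E i x y -> e y j = e x j.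
    move=> ji xy; rewrite /e; congr pair; apply/clE/Es.
    by case: ji => [/Em|->]; [exact|].
  split.
    case: HP => [->|[a /ltE[i ai aix] ->]]; first exact: filterT.
    have := Eo i x Logic.I; apply: filterS => y /(_ Logic.I) xy; apply/ltE; exists i => [j ji|].
      by rewrite (eE i) //; [exact: ai|left].
    by rewrite (eE i) //; right.
  case: HQ => [->|[a /ltE[i ai aix] ->]]; first exact: filterT.
  have := Eo i x Logic.I; apply: filterS => y /(_ Logic.I) xy; apply/ltE; exists i => [j ji|].
    by rewrite (eE i) //; [exact: ai|left].
  by rewrite (eE i) //; right.
- move=> x V /(Eb _ _ Logic.I)[i iV].
  (* [w 0] and [w 2] follow [e x] before [i] and bracket its value at [i], where [e] uses level
     [1]. *)
  pose w n : L := fun j => if `[< R j i >] then e x j else (cl i x, n).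
  have wlt n j : R j i -> w n j = e x j by move=> ji; rewrite /w asboolT.
  have wi n : w n i = (cl i x, n) by rewrite /w asboolF //; exact: wf_irrefl.
  exists [set f | (w 0%N < f)%O /\ (f < w 2%N)%O].
    apply: (@order_nbhsI _ _ _ [set f | (w 0%N < f)%O] [set f | (f < w 2%N)%O]) => //.
      right; exists (w 0%N) => //; apply/ltE; exists i => [j /wlt -> //|].
      by rewrite wi; right.
    right; exists (w 2%N) => //; apply/ltE; exists i => [j /wlt -> //|].
    by rewrite wi; right.
  move=> y /= [/ltE[k wk wky] /ltE[l wl wly]]; apply: iV => //.
  (* Before [i] both bounds agree with [e x], so a first difference there would put [e y] outside
     one of them. Hence both differences occur exactly at [i]. *)
  have ik : ~ R k i.
    move=> ki; rewrite wlt // in wky; have [kl|kl|lk] := Rtri k l.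
    - by move: wky; rewrite wl // wlt // => /(@sto_irrefl _ N _).
    - by subst l; move: wly; rewrite wlt // => /(sto_trans wky) /(@sto_irrefl _ N _).
    - by move: wly; rewrite -wk // !wlt //; [move=> /(@sto_irrefl _ N _)|exact: Rtr ki..].
  have il : ~ R l i.
    move=> li; rewrite wlt // in wly; have [kl|kl|lk] := Rtri k l.
    - by have ki := Rtr _ _ _ kl li.
    - by subst l.
    - by move: wly; rewrite -wk // wlt // => /(@sto_irrefl _ N _).
  have [//|ki|ik'] := Rtri k i; last by have := wk _ ik'; rewrite wi.
  have [//|li|il'] := Rtri l i; last by have := wl _ il'; rewrite wi.
  subst k l; move: wky wly; rewrite !wi /e /N /= /pair_lt /=.
  move=> [xy|[xy _]]; last by move=> _; apply/clE.
  move=> [yx|[yx _]]; last by apply/clE.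
  by case: (sto_irrefl (sto_trans xy yx)).
Qed.

(** * Discrete clopen bases versus non-archimedean structures *)

(** Near a point at most one member of the family is met. That member is clopen, so membership in it
    is locally constant, and membership in all others is locally false. *)
Lemma open_agreement {T : topologicalType} (F : set (set T)) (x : T) :
  go_discrete_family F -> (forall A, F A -> open A /\ closed A) ->
  open [set y | forall A, F A -> (A x <-> A y)].
Proof.
move=> Fd Foc; rewrite openE => y xy /=; rewrite /interior /=.
have [U Uy UF] := Fd y; have Uyy := nbhs_singleton Uy.
have [[A [FA UA]]|noA] := pselect (exists A, F A /\ U `&` A !=set0); last first.
  apply: filterS Uy => z Uz A FA; rewrite xy //.
  split=> [Ay|Az]; exfalso; apply: noA; exists A; split => //.
    by exists y.
  by exists z.
have [N Ny NA] : exists2 N, nbhs y N & forall z, N z -> (A y <-> A z).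
  have [oA cA] := Foc _ FA; have [Ay|nAy] := pselect (A y).
    by exists A => //; exact: open_nbhs_nbhs.
  exists (~` A) => //; apply: open_nbhs_nbhs; split => //.
  exact: closed_openC.
apply: (filterS _ (filterI Uy Ny)) => z [Uz Nz] B FB; rewrite xy //.
have [[w Bw]|noB] := pselect (U `&` B !=set0).
  have AB := UF _ _ FA FB UA (ex_intro _ w Bw); subst B; exact: NA.
split=> [By|Bz]; exfalso; apply: noB; last by exists z.
by exists y.
Qed.

Lemma discrete_nonarchimedean {T : topologicalType} :
  go_discrete_space T -> nonarchimedean [set: T] (fun _ _ : unit => False) (fun=> eq).
Proof.
move=> Td; split=> //.
- by split=> // i x y z -> ->.
- by move=> _ x _; apply: (@filterS _ _ _ [set x]) => [y -> //|]; apply: open_nbhs_nbhs.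
- by move=> x U _ Ux; exists tt => y _ <-; exact: nbhs_singleton.
Qed.

(** Points are equivalent at [i] when they lie in the same members of [Bs j] for all [j] up to [i].
    Under an initial well order fewer than [I] families precede [i], so the P-number makes the
    classes open. A discrete space, whose P-number is its cardinality, is treated apart with
    equality as the relation. *)
Lemma discrete_clopen_base_nonarchimedean {T : topologicalType} (I : Type) :
  go_Pnumber_is T I -> go_discrete_clopen_base T I ->
  exists (J : Type) (R : J -> J -> Prop) (E : J -> T -> T -> Prop),
    strict_well_order R /\ nonarchimedean [set: T] R E.
Proof.
move=> [_ PI] [Bs [Bd [Boc [_ Bb]]]].
have [Td|nTd] := pselect (go_discrete_space T).
  exists unit, (fun _ _ => False), (fun=> eq); split; last exact: discrete_nonarchimedean.
  by split=> //; move=> [] []; exact: Or32.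
have [{PI}PI _] := PI nTd.
have [R [Rtr Rtri Rwf] Rini] := exists_initial_well_order I.
pose V j x := [set y | forall A, Bs j A -> (A x <-> A y)].
have oV j x : open (V j x) by exact: (open_agreement x (Bd j) (Boc j)).
exists I, R, (fun i x y => forall j, R j i \/ j = i -> V j x y).
split=> //; split.
- split=> //.
  + by move=> i x y xy j ji A BA; rewrite (xy j ji A BA).
  + by move=> i x y z xy yz j ji A BA; rewrite (xy j ji A BA); exact: yz BA.
- move=> i j x y ij xy k [ki|->]; apply: xy; left => //; exact: Rtr ij.
- move=> i x _.
  have oI : open (\bigcap_(U in [set V j x | j in [set j | R j i]]) U).
    apply: PI => [|_ [j _ <-] //].
    have H : [set V j x | j in [set j | R j i]] #<= [set j | R j i] by exact: card_image_le.
    split; first by apply: (card_le_trans H); exact: subset_card_le.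
    by move=> /card_le_trans/(_ H); exact: Rini.
  have Vx j : V j x x by [].
  have nI : nbhs x (\bigcap_(U in [set V j x | j in [set j | R j i]]) U).
    by apply: open_nbhs_nbhs; split => // _ [j _ <-].
  have nV : nbhs x (V i x) by apply: open_nbhs_nbhs; split.
  apply: (filterS _ (filterI nI nV)) => y [yI yV] _ j [ji|-> //].
  by apply: yI; exists j.
- move=> x U _; rewrite nbhsE => -[W [oW Wx] WU].
  have [A [i _ BA] [Ax AW]] := Bb _ oW _ Wx.
  exists i => y _ xy; apply/WU/AW.
  by have /(_ i (or_intror erefl) A BA) <- := xy.
Qed.

(** The classes of one index partition the space into open sets. So they form a discrete family, and
    each is closed because its complement is a union of classes. *)
Lemma nonarchimedean_discrete_clopen_base {T : topologicalType} (I : Type)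
    (R : I -> I -> Prop) (E : I -> T -> T -> Prop) :
  nonarchimedean [set: T] R E -> go_discrete_clopen_base T I.
Proof.
move=> [[Er Es Et] Em Eo Eb].
have oE i x : open [set y | E i x y].
  rewrite openE => y /= xy; have := Eo i y Logic.I.
  by apply: filterS => z /(_ Logic.I); exact: Et.
exists (fun i => range (fun x => [set y | E i x y])); split; last split.
- move=> i x; exists [set y | E i x y].
    by apply: open_nbhs_nbhs; split => //; exact: Er.
  move=> _ _ [a _ <-] [b _ <-] [y /= [xy ay]] [z /= [xz bz]].
  have ab : E i a b.
    exact: (Et _ _ _ _ (Et _ _ _ _ ay (Es _ _ _ xy)) (Et _ _ _ _ xz (Es _ _ _ bz))).
  by apply/predeqP => w; split=> [aw|bw]; [exact: (Et _ _ _ _ (Es _ _ _ ab) aw)|exact: (Et _ _ _ _ ab bw)].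
- move=> i _ [x _ <-]; split => //.
  have -> : [set y | E i x y] = ~` \bigcup_(z in ~` [set y | E i x y]) [set y | E i z y].
    apply/predeqP => y; split=> /= [xy [z nxz zy]|H].
      by apply: nxz; exact: (Et _ _ _ _ xy (Es _ _ _ zy)).
    by apply: contrapT => nxy; apply: H; exists y => //; exact: Er.
  by apply: open_closedC; apply: bigcup_open.
- split; first by move=> _ [i _ [x _ <-]].
  move=> V oV x Vx; have [//|i iV] := Eb x V Logic.I; first exact: open_nbhs_nbhs.
  exists [set y | E i x y]; first by exists i => //; exists x.
  by split; [exact: Er|move=> y; exact: iV].
Qed.

(** * Separation of points, and suborderable powers *)

Definition T1_space (T : topologicalType) : Prop :=
  forall x y : T, x <> y -> exists2 U, nbhs x U & ~ U y.

Lemma T1_order {d} {L : orderTopologicalType d} : T1_space L.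
Proof.
move=> x y /eqP; rewrite neq_lt => /orP[xy|yx].
  exists [set z | (z < y)%O]; last by rewrite /= ltxx.
  apply: (@order_nbhsI _ _ x setT [set z | (z < y)%O]); [by left|by right; exists y|].
  by move=> z [].
exists [set z | (y < z)%O]; last by rewrite /= ltxx.
apply: (@order_nbhsI _ _ x [set z | (y < z)%O] setT); [by right; exists y|by left|].
by move=> z [].
Qed.

Lemma T1_embedding {S T : topologicalType} (e : S -> T) :
  embedding e -> T1_space T -> T1_space S.
Proof.
move=> [ei ec _] T1 x y xy; have [|U Ux Uy] := T1 (e x) (e y); first by move/ei.
by exists (e @^-1` U) => //; exact: ec.
Qed.

Lemma T1_power {T : topologicalType} n : T1_space T -> T1_space (go_power T n).
Proof.
move=> T1 x y xy; have [k xyk] : exists k, x k <> y k.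
  by apply: contrapT => /forallNP H; apply: xy; apply/funext => k; exact: contrapT.
have [U Ux Uy] := T1 _ _ xyk; exists [set s : go_power T n | U (s k)] => //.
exact: (@proj_continuous _ (fun=> T) k x U Ux).
Qed.

Lemma discrete_clopen_base_power_suborderable {T : topologicalType} (I : Type) n :
  T1_space T -> (0 < n)%N -> go_Pnumber_is T I -> go_discrete_clopen_base T I ->
  go_suborderable (go_power T n).
Proof.
move=> T1 n0 TI TB.
have [J [R [E [RW RE]]]] := discrete_clopen_base_nonarchimedean TI TB.
apply: (nonarchimedean_suborderable (T1_power T1) RW).
exact: (nonarchimedean_power RW n0 RE).
Qed.

(** * Complete normality *)

(** Neither set meets the closure of the other. Unlike normality, this separation property passes to
    every subspace. *)
Definition completely_normal (T : topologicalType) : Prop :=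
  forall H K : set T,
    (forall h, H h -> nbhs h (~` K)) -> (forall k, K k -> nbhs k (~` H)) ->
    exists G G' : set T, [/\ (forall h, H h -> nbhs h G),
      (forall k, K k -> nbhs k G') & forall x, G x -> ~ G' x].

Lemma completely_normal_embedding {S T : topologicalType} (e : S -> T) :
  embedding e -> completely_normal T -> completely_normal S.
Proof.
move=> [ei ec eo] CT H K HK KH.
have [h [h' Hh hH]|_ [k Kk <-]|G [G' [HG KG GG]]] := CT (e @` H) (e @` K).
- rewrite -hH; have [U Uh UK] := eo _ _ (HK h' Hh).
  by apply: filterS Uh => _ /[swap] -[k Kk <-] /UK.
- have [U Uk UH] := eo _ _ (KH k Kk).
  by apply: filterS Uk => _ /[swap] -[h Hh <-] /UH.
exists (e @^-1` G), (e @^-1` G'); split.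
- by move=> h Hh; apply: ec; apply: HG; exists h.
- by move=> k Kk; apply: ec; apply: KG; exists k.
- by move=> x; exact: GG.
Qed.

(* Each [x] gets a convex neighbourhood, shrunk on either side to the part before the
   first point (for an auxiliary well order) of that side.  If the shrunk
   neighbourhoods of x < y met, the points chosen on the right of x and on the
   left of y would both lie in the two convex sets, hence coincide. *)
Lemma completely_normal_order {d} {L : orderTopologicalType d} : completely_normal L.
Proof.
move=> H K HK KH.
have [S [Str Stri Swf]] := exists_strict_well_order L.
have convN (x : L) (U : set L) : exists J : set L, nbhs x U ->
    [/\ nbhs x J, J `<=` U & forall a b c, J a -> J c -> (a <= b)%O -> (b <= c)%O -> J b].
  have [Ux|] := pselect (nbhs x U); last by exists set0.
  have [P [Q [HP HQ PQU]]] := order_nbhsE Ux; exists (P `&` Q) => _; split=> //.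
    exact: (order_nbhsI HP HQ).
  move=> a b c [Pa Qa] [Pc Qc] ab bc; split.
    by case: HP Pa => [->//|[p _ ->]] /= /lt_le_trans; apply.
  by case: HQ Qc => [->//|[p _ ->]] /=; exact: le_lt_trans.
pose J x U := projT1 (cid (convN x U)).
have JP x U : nbhs x U -> [/\ nbhs x (J x U), J x U `<=` U &
    forall a b c, J x U a -> J x U c -> (a <= b)%O -> (b <= c)%O -> J x U b].
  exact: projT2 (cid (convN x U)).
pose least (P : set L) r := P r /\ forall s, P s -> ~ S s r.
have leastE (P : set L) : P !=set0 -> exists r, least P r.
  by move=> /(wf_least Swf)[r Pr rP]; exists r; split=> // s Ps /rP.
have least_eq (P : set L) r s : least P r -> least P s -> r = s.
  move=> [Pr rP] [Ps sP]; have [/sP|//|/rP] := Stri r s; exact.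
pose right x U := [set r | (x < r)%O /\ J x U r].
pose left x U := [set l | (l < x)%O /\ J x U l].
pose mu x U := [set q | [/\ J x U q, (forall r, least (right x U) r -> (q < r)%O) &
                           (forall l, least (left x U) l -> (l < q)%O)]].
have muN x U : nbhs x U -> nbhs x (mu x U).
  move=> /JP[Jx _ _].
  have N1 : nbhs x [set q | forall r, least (right x U) r -> (q < r)%O].
    have [[r rl]|nr] := pselect (exists r, least (right x U) r); last first.
      by apply: (@filterS _ _ _ setT); [move=> q _ r rl; case: nr; exists r|exact: filterT].
    apply: (@order_nbhsI _ _ x setT [set q | (q < r)%O]); first by left.
      by right; exists r => //; case: rl => -[].
    by move=> q [_ qr] s /(least_eq _ _ _ rl) <-.
  have N2 : nbhs x [set q | forall l, least (left x U) l -> (l < q)%O].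
    have [[l ll]|nl] := pselect (exists r, least (left x U) r); last first.
      by apply: (@filterS _ _ _ setT); [move=> q _ r rl; case: nl; exists r|exact: filterT].
    apply: (@order_nbhsI _ _ x [set q | (l < q)%O] setT); last by move=> q [lq _] s /(least_eq _ _ _ ll) <-.
      by right; exists l => //; case: ll => -[].
    by left.
  by apply: (filterS _ (filterI Jx (filterI N1 N2))) => q [? []].
have mu_lt x y U V q : nbhs x U -> nbhs y V -> (x < y)%O -> ~ U y -> ~ V x ->
    mu x U q -> mu y V q -> False.
  move=> Ux Vy xy nUy nVx [Jq qr _] [J'q _ lq].
  have [Jx JU Jc] := JP _ _ Ux; have [J'y J'V J'c] := JP _ _ Vy.
  have {}Jx := nbhs_singleton Jx; have {}J'y := nbhs_singleton J'y.
  have qy : (q < y)%O.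
    by rewrite ltNge; apply/negP => yq; apply/nUy/JU; exact: Jc Jx Jq (ltW xy) yq.
  have xq : (x < q)%O.
    by rewrite ltNge; apply/negP => qx; apply/nVx/J'V; exact: J'c J'q J'y qx (ltW xy).
  have [|r rl] := leastE (right x U); first by exists q.
  have [|l ll] := leastE (left y V); first by exists q.
  have [[xr Jr] rS] := rl; have [[ly J'l] lS] := ll.
  have {}qr := qr _ rl; have {}lq := lq _ ll.
  have ry : (r < y)%O.
    by rewrite ltNge; apply/negP => yr; apply/nUy/JU; exact: Jc Jx Jr (ltW xy) yr.
  have xl : (x < l)%O.
    by rewrite ltNge; apply/negP => lx; apply/nVx/J'V; exact: J'c J'l J'y lx (ltW xy).
  (* [r] also qualifies on the left of [y], and [l] on the right of [x]. Minimality excludes both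
     strict cases, and equality contradicts [l < q < r]. *)
  have [rl'|rl'|lr] := Stri r l.
  - apply: (lS r) => //; split => //.
    exact: J'c J'q J'y (ltW qr) (ltW ry).
  - by have := lt_trans lq qr; rewrite rl' ltxx.
  - apply: (rS l) => //; split => //.
    exact: Jc Jx Jq (ltW xl) (ltW lq).
exists (\bigcup_(h in H) mu h (~` K)), (\bigcup_(k in K) mu k (~` H)); split.
- by move=> h Hh; apply: filterS (muN _ _ (HK _ Hh)) => q; exists h.
- by move=> k Kk; apply: filterS (muN _ _ (KH _ Kk)) => q; exists k.
- move=> q [h Hh hq] [k Kk kq].
  have [hk|kh|E] := ltgtP h k.
  + by apply: (mu_lt _ _ _ _ _ (HK _ Hh) (KH _ Kk) hk) hq kq => // [].
  + by apply: (mu_lt _ _ _ _ _ (KH _ Kk) (HK _ Hh) kh) kq hq => // [].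
  + by subst k; have := nbhs_singleton (HK _ Hh).
Qed.

Lemma homeomorphic_embedding {S T : topologicalType} :
  go_homeomorphic S T -> exists e : S -> T, embedding e.
Proof.
by move=> [f [g [fK [gK [fc gc]]]]]; exists f; exact: embedding_cancel fK fc gc.
Qed.

Lemma homeomorphic_sym {S T : topologicalType} :
  go_homeomorphic S T -> go_homeomorphic T S.
Proof. by move=> [f [g [fK [gK [fc gc]]]]]; exists g, f. Qed.

Lemma suborderable_completely_normal {T : topologicalType} :
  go_suborderable T -> completely_normal T.
Proof.
move=> [d [L [A /homeomorphic_embedding[e eE]]]].
exact: completely_normal_embedding (embedding_comp eE (embedding_val _))
  completely_normal_order.
Qed.

(** * Subspaces of ordinals and comparison of characters *)

Section SubspaceOfOrdinal.
Variables (d : Order.disp_t) (W : orderTopologicalType d).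
Hypothesis Wwf : go_well_ordered W.

Lemma wo_least (P : set W) : P !=set0 -> exists2 m, P m & forall y, P y -> (m <= y)%O.
Proof.
by move=> /(wf_least Wwf)[m Pm mP]; exists m => // y Py; rewrite leNgt; apply/negP => /mP.
Qed.

(** This segment is the open ray below the successor of [p], or everything if [p] is the last
    point. *)
Lemma wo_nbhs_le (p : W) : nbhs p [set z | (z <= p)%O].
Proof.
have [[q pq]|nq] := pselect (exists q, (p < q)%O); last first.
  apply: (@filterS _ _ _ setT); last exact: filterT.
  by move=> z _ /=; rewrite leNgt; apply/negP => pz; apply: nq; exists z.
have [|m /= pm mP] := @wo_least [set q | (p < q)%O]; first by exists q.
apply: (@order_nbhsI _ _ p setT [set z | (z < m)%O]); [by left|by right; exists m|].
by move=> z [_ /= zm]; rewrite leNgt; apply/negP => /mP; rewrite leNgt zm.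
Qed.

Lemma order_nbhs_gt (w p : W) : (w < p)%O -> nbhs p [set z | (w < z)%O].
Proof.
move=> wp; apply: (@order_nbhsI _ _ p [set z | (w < z)%O] setT);
  [by right; exists w|by left|by move=> z []].
Qed.

(** The second alternative is the least point, which has no [w] below it. *)
Lemma order_nbhs_below (p : W) U : nbhs p U ->
  (exists2 w, (w < p)%O & forall z, (w < z)%O -> (z <= p)%O -> U z) \/
  (forall z, (p <= z)%O) /\ U p.
Proof.
move=> /[dup] /nbhs_singleton Up /order_nbhsE[P [Q [HP HQ PQU]]].
have Qle z : (z <= p)%O -> Q z.
  by move=> zp; case: HQ => [->//|[b pb ->]]; exact: le_lt_trans pb.
case: HP => [PT|[a ap PE]]; last first.
  by left; exists a => // z az zp; apply: PQU; split; [rewrite PE|exact: Qle].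
have [[w wp]|nw] := pselect (exists w, (w < p)%O).
  by left; exists w => // z _ zp; apply: PQU; split; [rewrite PT|exact: Qle].
by right; split => // z; rewrite leNgt; apply/negP => zp; apply: nw; exists z.
Qed.

Variable X : set W.
Local Notation T := (set_type X).

Lemma sub_nbhsI (p : T) w (U : set T) : (w < val p)%O ->
  (forall z : T, (w < val z)%O -> (val z <= val p)%O -> U z) -> nbhs p U.
Proof.
move=> wp H; apply/nbhs_set_type.
exists [set z | (w < z)%O /\ (z <= val p)%O]; last by move=> z [? ?]; exact: H.
exact: filterI (order_nbhs_gt wp) (wo_nbhs_le _).
Qed.

Lemma isolatedP (p : T) : go_isolated p <-> nbhs p [set p].
Proof.
split=> [op|pN]; first by apply: open_nbhs_nbhs.
by rewrite /go_isolated openE => _ ->.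
Qed.

Lemma sub_nbhsE (p : T) (U : set T) : ~ go_isolated p -> nbhs p U ->
  exists2 w, (w < val p)%O & forall z : T, (w < val z)%O -> (val z <= val p)%O -> U z.
Proof.
move=> pI /nbhs_set_type[V /order_nbhs_below[[w wp wV]|[pmin _]] VU].
  by exists w => // z wz zp; apply: VU; exact: wV.
exfalso; apply/pI/isolatedP/nbhs_set_type.
exists [set z | (z <= val p)%O]; first exact: wo_nbhs_le.
by move=> y /= yp; apply/val_inj/le_anti; rewrite yp pmin.
Qed.

Lemma nonisolated_between (p : T) w : ~ go_isolated p -> (w < val p)%O ->
  exists2 z : T, (w < val z)%O & (val z < val p)%O.
Proof.
move=> pI wp; apply: contrapT => H; apply/pI/isolatedP.
apply: (@sub_nbhsI _ w) => // z wz; rewrite le_eqVlt => /orP[/eqP/val_inj//|zp].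
by exfalso; apply: H; exists z.
Qed.

Lemma nonisolated_nbhs_below (p : T) U : ~ go_isolated p -> nbhs p U ->
  exists2 z : T, (val z < val p)%O & U z.
Proof.
move=> pI /(sub_nbhsE pI)[w wp wU]; have [z wz zp] := nonisolated_between pI wp.
by exists z => //; apply: wU => //; exact: ltW.
Qed.

Lemma T1_sub : T1_space T.
Proof. exact: T1_embedding (embedding_val X) T1_order. Qed.

(** A separation of the two sets yields, for each [B] in [By], a point [b B] of [B] below [y] and a
    bound [g B] below [x] with [(a, b B)] in [G'] for all [a] in the interval from [g B] to [x].
    These intervals form a local base at [x]: otherwise some [a] below [x] exceeds every [g B], and
    a neighbourhood of [(a, y)] inside [G] contains some [(a, b B)]. *)
Lemma completely_normal_character (x y : T) : completely_normal (T * T)%type ->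
  ~ go_isolated x -> ~ go_isolated y -> go_character_le x y.
Proof.
move=> CN xI yI By [Byo Byb].
have [h|k|G [G' [HG KG GG]]] :=
    CN [set p | (val p.1 < val x)%O /\ p.2 = y] [set p | p.1 = x /\ (val p.2 < val y)%O].
- case: h => a b /= [ax ->]; have [|U Ua Ux] := @T1_sub a x.
    by move=> axE; rewrite axE ltxx in ax.
  exists (U, setT); first by split => //; exact: filterT.
  by move=> [a' b'] /= [Ua' _] [a'x _]; subst a'.
- case: k => a b /= [-> by_]; have [|U Ub Uy] := @T1_sub b y.
    by move=> byE; rewrite byE ltxx in by_.
  exists (setT, U); first by split => //; exact: filterT.
  by move=> [a' b'] /= [_ Ub'] [_ b'y]; subst b'.
have bP (B : set T) : exists b, By B -> B b /\ (val b < val y)%O.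
  have [/Byo[oB By_]|] := pselect (By B); last by exists y.
  have [|b byl Bb] := @nonisolated_nbhs_below y B yI; first exact: open_nbhs_nbhs.
  by exists b.
have /choice[b {}bP] := bP.
have gP (B : set T) : exists w, By B -> (w < val x)%O /\
    forall a : T, (w < val a)%O -> (val a <= val x)%O -> G' (a, b B).
  have [/bP[Bb bl]|] := pselect (By B); last by exists (val x).
  have /= [//|[A C] /= [Ax Cb] AC] := KG (x, b B).
  have [w wx wA] := sub_nbhsE xI Ax; exists w => _; split => // a wa ax.
  by apply: AC; split => /=; [exact: wA|exact: nbhs_singleton].
have /choice[g {}gP] := gP.
exists [set [set a : T | (g B < val a)%O /\ (val a <= val x)%O] | B in By].
split; last exact: card_image_le.
split=> [_ [B /gP[gx _] <-]|V /(sub_nbhsE xI)[w wx wV]].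
  split; last by split.
  rewrite openE => a /= [ga ax]; apply: (@sub_nbhsI a (g B)) => // z gz za.
  by split => //; exact: le_trans ax.
have [[B BB wg]|H] := pselect (exists2 B, By B & (w <= g B)%O).
  exists [set a : T | (g B < val a)%O /\ (val a <= val x)%O]; first by exists B.
  by move=> a [ga ax]; apply: wV => //; exact: le_lt_trans ga.
have [a wa ax] := nonisolated_between xI wx.
have /= [//|[A C] /= [Aa Cy] AC] := HG (a, y).
have [B BB BC] := Byb _ Cy.
exfalso; apply: (GG (a, b B)).
  by apply: AC; split => /=; [exact: nbhs_singleton|apply: BC; case: (bP B BB)].
have [_] := gP _ BB; apply; last exact: ltW.
apply: lt_trans wa; rewrite ltNge; apply/negP => wg; apply: H; by exists B.
Qed.

End SubspaceOfOrdinal.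

(** * Squares of stationary sets *)

Section StationarySquare.
Variables (d : Order.disp_t) (K : orderTopologicalType d).
Hypothesis Kreg : go_regular_uncountable_cardinal K.

Let Kwf : go_well_ordered K. Proof. by case: Kreg. Qed.

Lemma regular_bounded (C : set K) : ~ ([set: K] #<= C) ->
  exists k, forall c, C c -> (c < k)%O.
Proof.
have [_ [_ [_ Kc]]] := Kreg; move=> nKC; apply: contrapT => /forallNP H.
apply/nKC/Kc => k; have /existsNP[c /not_implyP[Cc ck]] := H k.
by exists c => //; rewrite leNgt; apply/negP.
Qed.

Lemma regular_countable_bounded (C : set K) : countable C ->
  exists k, forall c, C c -> (c < k)%O.
Proof.
have [_ [_ [Kunc _]]] := Kreg; move=> Cc; apply: regular_bounded => KC; apply: Kunc.
exact: card_le_trans KC Cc.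
Qed.

Lemma regular_above (k : K) : exists k', (k < k')%O.
Proof.
by have [|k' /(_ _ erefl)] := @regular_countable_bounded [set k]; [exact: countable1|exists k'].
Qed.

(** Limits from below. The first clause excludes the least element, for which the second is
    vacuous. *)
Definition limit_of (D : set K) : set K :=
  [set l | (exists j, (j < l)%O) /\
    forall j, (j < l)%O -> exists2 e, D e & (j < e)%O /\ (e < l)%O].

(** Unboundedness: above [k] an increasing sequence is chosen in [D]. It is bounded because
    countable sets are, and its supremum is a limit of [D]. *)
Lemma club_limit_of (D : set K) : (forall k, exists2 e, D e & (k <= e)%O) ->
  go_club (limit_of D).
Proof.
move=> Dunb; split.
  rewrite -[limit_of D]setCK; apply: open_closedC; rewrite openE => p /= nlp.
  have [[j jp nj]|H] := pselect (exists2 j, (j < p)%O &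
      forall e, D e -> (j < e)%O -> (e < p)%O -> False); last first.
    have nmin j : ~ (j < p)%O.
      move=> jp; apply: nlp; split; first by exists j.
      move=> i ip; apply: contrapT => Hi; apply: H; exists i => // e De ie ep.
      by apply: Hi; exists e.
    apply: (filterS _ (wo_nbhs_le Kwf p)) => z /= zp [[j jz] _].
    exact: (nmin j (lt_le_trans jz zp)).
  apply: (filterS _ (filterI (order_nbhs_gt jp) (wo_nbhs_le Kwf p))) => z [/= jz zp] [_ zl].
  by have [e De [je ez]] := zl _ jz; exact: nj De je (lt_le_trans ez zp).
move=> k.
have nextP j : exists e, D e /\ (j < e)%O.
  have [j' jj'] := regular_above j; have [e De j'e] := Dunb j'.
  by exists e; split => //; exact: lt_le_trans j'e.
have /choice[f fP] := nextP.
have [|b0 b0P] := @regular_countable_bounded (range (fun n => iter n f k)).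
  exact: card_image_le.
have [|b bP bmin] := @wo_least _ _ Kwf [set b | forall n, (iter n f k < b)%O].
  by exists b0 => n; apply: b0P; exists n.
exists b; last exact: ltW (bP 0%N).
split; first by exists k; exact: (bP 0%N).
move=> j jb; have /existsNP[n nj] : ~ (forall n, (iter n f k < j)%O).
  by move=> /bmin; rewrite leNgt jb.
exists (iter n.+1 f k); first by case: (fP (iter n f k)).
split; last exact: bP.
by apply: (@le_lt_trans _ _ (iter n f k)); [rewrite leNgt; apply/negP|case: (fP (iter n f k))].
Qed.

Variable S : set K.
Hypothesis Sst : go_stationary S.
Local Notation T := (set_type S).

Lemma limit_of_sub (D : set T) (l : K) (Sl : l \in S) :
  limit_of (val @` D) l -> forall U, nbhs (exist _ l Sl : T) U ->
  exists2 e : T, D e & (val e < l)%O /\ U e.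
Proof.
move=> [[j jl] ll] U /nbhs_set_type[V /order_nbhs_below[[w wl wV]|[lmin _]] VU].
  have [_ [e De <-] [we el]] := ll _ wl; exists e => //; split=> //.
  by apply: VU; apply: wV => //; exact: ltW.
by have := lmin j; rewrite /= leNgt jl.
Qed.

(** The limits of an unbounded part of [S] form a club, which [S] must meet. *)
Lemma stationary_limit (D : set T) :
  (forall k, exists2 e, D e & (k <= val e)%O) ->
  exists l : T, ~ go_isolated l /\
    forall U, nbhs l U -> exists2 e : T, D e & (val e < val l)%O /\ U e.
Proof.
move=> Dunb.
have [|l [/mem_set Sl ll]] := Sst (@club_limit_of (val @` D) _).
  by move=> k; have [e De ke] := Dunb k; exists (val e) => //; exists e.
exists (exist _ l Sl); split; last exact: limit_of_sub.
move=> /isolatedP /(limit_of_sub ll)[e _ [el eE]].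
by rewrite eE /= ltxx in el.
Qed.

Lemma stationary_unbounded k : exists2 s : T, True & (k <= val s)%O.
Proof.
have [|s [/mem_set Ss ks]] := @Sst [set z | (k <= z)%O].
  split; first by have := @lray_closed _ K k; have := @rray_closed _ K k; rewrite !set_itvE.
  move=> j; have [jk|/ltW kj] := leP j k; first by exists k => //=.
  by exists j => //=.
by exists (exist _ s Ss).
Qed.

(** The least element of [S] above [k] is isolated in [S]. *)
Lemma stationary_isolated_unbounded k : exists2 s : T, go_isolated s & (k < val s)%O.
Proof.
have [k' kk'] := regular_above k; have [s0 _ ks0] := stationary_unbounded k'.
have [|_ [s ks <-] smin] := @wo_least _ _ Kwf (val @` [set s : T | (k < val s)%O]).
  by exists (val s0); exists s0 => //=; exact: lt_le_trans ks0.
exists s => //; apply/isolatedP; apply: (@sub_nbhsI _ _ Kwf _ _ k) => // z kz zs.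
by apply/val_inj/le_anti; rewrite zs smin //; exists z.
Qed.

Lemma stationary_square_not_completely_normal : ~ completely_normal (T * T)%type.
Proof.
move=> CN; have [_ [Kini _]] := Kreg.
have [|alpha [aI _]] := @stationary_limit setT.
  by move=> k; have [s _ ks] := stationary_unbounded k; exists s.
have [h|k|G [G' [HG KG GG]]] := CN
    [set p | ~ go_isolated p.1 /\ (val p.2 < val alpha)%O]
    [set p | go_isolated p.1 /\ p.2 = alpha].
- case: h => a b /= [_ ba]; have [|U Ub Ua] := @T1_sub _ _ S b alpha.
    by move=> bE; rewrite bE ltxx in ba.
  exists (setT, U); first by split => //; exact: filterT.
  by move=> [a' b'] /= [_ Ub'] [_ b'a]; subst b'.
- case: k => a b /= [/isolatedP aiso ->].
  exists ([set a], setT); first by split => //; exact: filterT.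
  by move=> [a' b'] /= [-> _] [na _]; apply/na/isolatedP.
have aP (s : T) : exists a : T, go_isolated s -> (val a < val alpha)%O /\ G' (s, a).
  have [sI|] := pselect (go_isolated s); last by exists s.
  have /= [//|[A C] /= [As Ca] AC] := KG (s, alpha).
  have [z za Cz] := nonisolated_nbhs_below Kwf aI Ca.
  by exists z => _; split => //; apply: AC; split => //=; exact: nbhs_singleton.
have /choice[a {}aP] := aP.
pose D a0 := [set s : T | go_isolated s /\ a s = a0].
(* If one value [a0] serves unboundedly many isolated [s], these accumulate at some [l] in [S], and
   every neighbourhood of [(l, a0)] meets [G']. *)
have [[a0 a0l Da0]|H] := pselect (exists2 a0 : T, (val a0 < val alpha)%O &
    forall k, exists2 e, D a0 e & (k <= val e)%O).
  have [l [lI lD]] := stationary_limit Da0.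
  have /= [//|[A C] /= [Al Ca0] AC] := HG (l, a0).
  have [s [sI sa] [_ As]] := lD _ Al.
  apply: (GG (s, a0)); first by apply: AC; split => //=; exact: nbhs_singleton.
  by have [_] := aP s sI; rewrite sa.
(* Otherwise every fibre of [a] is bounded. There are fewer than [|K|] bounds, so they have a common
   bound [k], yet isolated points exist above [k]. *)
have bP (a0 : T) : exists b, (val a0 < val alpha)%O -> forall s, D a0 s -> (val s < b)%O.
  have [a0l|] := pselect (val a0 < val alpha)%O; last by exists (val a0).
  have /existsNP[b Hb] : ~ forall k, exists2 e, D a0 e & (k <= val e)%O.
    by move=> Da0; apply: H; exists a0.
  exists b => _ s Ds; rewrite ltNge; apply/negP => bs; apply: Hb; by exists s.
have /choice[b {}bP] := bP.
have [|k kP] := @regular_bounded [set b a0 | a0 in [set a0 : T | (val a0 < val alpha)%O]].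
  move=> KB; have [_] := Kini (val alpha); apply.
  apply: (card_le_trans KB); apply: (card_le_trans (card_image_le _ _)).
  by apply: (@card_le_injI _ _ _ _ val) => // x y _ _ /val_inj.
have [s sI ks] := stationary_isolated_unbounded k.
have [al _] := aP s sI.
have sb := bP (a s) al s (conj sI erefl).
have bk : (b (a s) < k)%O by apply: kP; exists (a s).
by have := lt_trans (lt_trans ks sb) bk; rewrite ltxx.
Qed.

End StationarySquare.

Lemma completely_normal_square_not_stationary {T : topologicalType} {d}
    (K : orderTopologicalType d) (S : set K) (Y : set T) :
  completely_normal (T * T)%type -> go_regular_uncountable_cardinal K ->
  go_stationary S -> ~ go_homeomorphic (set_type Y) (set_type S).
Proof.
move=> CN Kreg Sst /homeomorphic_sym/homeomorphic_embedding[e eE].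
apply: (stationary_square_not_completely_normal Kreg Sst).
have eT := embedding_comp eE (embedding_val Y).
exact: completely_normal_embedding (embedding_map_pair eT eT) CN.
Qed.

(** * Thin cofinal sets *)

Lemma embedding_factor {S T Z : topologicalType} (e : S -> T) (f : T -> Z) :
  embedding f -> embedding (f \o e) -> embedding e.
Proof.
move=> [fi fc fo] [ei ec eo]; split.
- by move=> x y exy; apply: ei; rewrite /= exy.
- move=> x V /fo[U Ux UV].
  have ecU : nbhs x ((f \o e) @^-1` U) := ec x U Ux.
  by apply: (@filterS _ (nbhs x) _ _ (e @^-1` V) _ ecU) => y; exact: UV.
- move=> x V /eo[U Ux UV]; exists (f @^-1` U); first exact: fc.
  by move=> y; exact: UV.
Qed.

Section ThinCofinalSet.
Variables (d : Order.disp_t) (W : orderTopologicalType d).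
Hypothesis Wwf : go_well_ordered W.
Variable M : set W.
Hypothesis Mdown : forall x y, M x -> (y <= x)%O -> M y.
Hypothesis Mnomax : forall x, M x -> exists2 y, M y & (x < y)%O.

Definition cofinal_in (C : set W) : Prop :=
  C `<=` M /\ forall w, M w -> exists2 c, C c & (w <= c)%O.

Lemma cofinal_in_lt C w : cofinal_in C -> M w -> exists2 c, C c & (w < c)%O.
Proof.
move=> [_ CM] /Mnomax[y /CM[c Cc yc] wy]; exists c => //; exact: lt_le_trans yc.
Qed.

Section Thin.
Variables (A : set W) (R : set_type A -> set_type A -> Prop).
Hypothesis RW : strict_well_order R.
Hypothesis Acof : cofinal_in A.

(* On records the auxiliary well order [R] agrees with the order of [W]. *)
Definition records : set (set_type A) :=
  [set a | forall b, R b a -> (val b < val a)%O].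

Lemma records_cofinal : cofinal_in (val @` records).
Proof.
have [Rtr Rtri Rwf] := RW; have [AM Ac] := Acof; split.
  by move=> _ [a _ <-]; apply: AM; exact: set_mem (valP a).
move=> w Mw; have [|a wa amin] := @wf_least _ _ [set a : set_type A | (w <= val a)%O] Rwf.
  by have [c Cc wc] := Ac _ Mw; exists (exist _ c (mem_set Cc)).
exists (val a) => //; exists a => // b /amin /= bw.
by apply: lt_le_trans wa; rewrite ltNge; apply/negP.
Qed.

Lemma records_lt a b : records a -> records b -> (val a < val b)%O -> R a b.
Proof.
have [Rtr Rtri Rwf] := RW; move=> ra rb ab; have [//|E|/ra ba] := Rtri a b.
  by rewrite E ltxx in ab.
by have := lt_trans ab ba; rewrite ltxx.
Qed.

End Thin.

(* Taking records along an injection into [nat] yields a cofinal set of type omega,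
   which has no limit point in [M]. *)
Lemma countable_cofinal_no_limit (A : set W) : cofinal_in A -> countable A ->
  exists2 C, cofinal_in C & forall l, M l -> ~ limit_of C l.
Proof.
move=> Acof /card_le_injE[f [_ finj]].
pose R (a b : set_type A) := (f a < f b)%N.
have RW : strict_well_order R.
  split.
  - by move=> i j k; exact: ltn_trans.
  - move=> i j; rewrite /R; case: (ltngtP (f i) (f j)) => [ij|ji|/finj ij];
      [exact: Or31|exact: Or33|exact: Or32].
  - apply: (Inverse_Image.wf_inverse_image _ _ (fun m n => (m < n)%N) f).
    by move=> n; elim/ltn_ind: n => n IH; constructor => m /IH.
have Ccof := records_cofinal RW Acof.
exists (val @` records R) => // l Ml [[j jl] ll].
have [_ [a ra <-] la] := cofinal_in_lt Ccof Ml.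
have H n : exists2 b, records R b & (val b < l)%O /\ (n <= f b)%N.
  elim: n => [|n [b rb [bl nb]]].
    by have [_ [e re <-] [_ el]] := ll _ jl; exists e.
  have [_ [e re <-] [be el]] := ll _ bl; exists e => //; split => //.
  exact: leq_ltn_trans nb (records_lt RW rb re be).
have [b rb [bl ab]] := H (f a).
have := records_lt RW rb ra (lt_trans bl la).
by rewrite /R ltnNge ab.
Qed.

Variables (A : set W) (R : set_type A -> set_type A -> Prop).
Hypothesis Acof : cofinal_in A.
Hypothesis Amin : forall C, cofinal_in C -> A #<= C.
Hypothesis RW : strict_well_order R.
Hypothesis Rini : forall a, ~ ([set: set_type A] #<= [set b | R b a]).
Variable m0 : W.
Hypothesis Mm0 : M m0.

Let A' : set W := val @` records R.

(** The closure of the records within [M]; it will carry the regular cardinal. *)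
Let D : set W := [set z | M z /\ (A' z \/ limit_of A' z)].

Let nextP : {nx : W -> set_type A | forall z, M z ->
  [/\ records R (nx z), (z < val (nx z))%O &
    forall a, records R a -> (z < val a)%O -> (val (nx z) <= val a)%O]}.
Proof.
have Ccof := records_cofinal RW Acof.
suff H z : exists a, M z -> [/\ records R a, (z < val a)%O &
    forall b, records R b -> (z < val b)%O -> (val a <= val b)%O].
  exists (fun z => projT1 (cid (H z))) => z; exact: (projT2 (cid (H z))).
have [Mz|] := pselect (M z); last first.
  by have [a Aa _] := (snd Acof) _ Mm0; exists (exist _ a (mem_set Aa)).
have [_ [a ra <-] za] := cofinal_in_lt Ccof Mz.
have [|_ [[b rb <-] /= zb] bmin] := @wo_least _ _ Wwf (A' `&` [set c | (z < c)%O]).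
  by exists (val a); split => //; exists a.
by exists b => _; split => // c rc zc; apply: bmin; split => //; exists c.
Qed.

Let nx := projT1 nextP.
Let nxP z : M z -> [/\ records R (nx z), (z < val (nx z))%O &
    forall a, records R a -> (z < val a)%O -> (val (nx z) <= val a)%O].
Proof. exact: (projT2 nextP). Qed.

Let nx_le y z : M y -> D z -> (y < z)%O -> (val (nx y) <= z)%O.
Proof.
move=> My [Mz Dz] yz; have [ry yny ymin] := nxP My.
case: Dz yz => [[a ra <-] ya|[_ lz] /lz[_ [a ra <-] [ya az]]]; first exact: ymin.
exact: le_trans (ymin _ ra ya) (ltW az).
Qed.

Let A'D : A' `<=` D.
Proof.
have [CM _] := records_cofinal RW Acof.
by move=> a Aa; split; [exact: CM|left].
Qed.

Let D_closed l : M l -> limit_of D l -> D l.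
Proof.
move=> Ml [lj ll]; split => //; right; split => // j jl.
have [y Dy [jy yl]] := ll _ jl; have [z Dz [yz zl]] := ll _ yl.
have My : M y by case: Dy.
have [ry yny _] := nxP My.
exists (val (nx y)); first by exists (nx y).
by split; [exact: lt_trans yny|exact: le_lt_trans (nx_le My Dz yz) zl].
Qed.

Let N : strict_total_order (set_type D).
Proof.
apply: (@StrictTotalOrder _ (fun x y : set_type D => (val x < val y)%O)).
- by move=> x; rewrite ltxx.
- by move=> x y z; exact: lt_trans.
- by move=> x y; case: (ltgtP (val x) (val y)) => [?|?|/val_inj ?];
    [exact: Or31|exact: Or33|exact: Or32].
Defined.

(** [D] with its own order topology; [thin_embedding] shows that this is the subspace topology. *)
Let K := order_topology (ordered_by N).
Let iota (k : K) : W := val (k : set_type D).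

Let DK (k : K) : D (iota k). Proof. exact: set_mem (valP (k : set_type D)). Qed.

Let MK (k : K) : M (iota k). Proof. by case: (DK k). Qed.

Let ltK (x y : K) : (x < y)%O = (iota x < iota y)%O.
Proof. by rewrite ordered_by_ltE; apply/asboolP/idP. Qed.

Let leK (x y : K) : (x <= y)%O = (iota x <= iota y)%O.
Proof. by rewrite leNgt ltK -leNgt. Qed.

Let iota_inj : injective iota.
Proof. by move=> x y /val_inj. Qed.

Let toK z : D z -> exists k : K, iota k = z.
Proof. by move=> Dz; exists (exist _ z (mem_set Dz) : set_type D). Qed.

Let Kwf : go_well_ordered K.
Proof.
have := Inverse_Image.wf_inverse_image _ _ (fun x y : W => is_true (x < y)%O) iota Wwf.
by congr well_founded; apply/funext => x; apply/funext => y; rewrite ltK.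
Qed.

Let nx_iota_inj (x y : K) : nx (iota x) = nx (iota y) -> x = y.
Proof.
have lt a b : (iota a < iota b)%O -> nx (iota a) <> nx (iota b).
  move=> ab nab; have := nx_le (MK a) (DK b) ab; rewrite nab leNgt.
  by have [_ -> _] := nxP (MK b).
move=> nxy; case: (ltgtP (iota x) (iota y)) => [/lt //|/lt /(_ (esym nxy)) //|].
exact: iota_inj.
Qed.

Let cofinalK (C : set K) : (forall k, exists2 c, C c & (k <= c)%O) ->
  cofinal_in (iota @` C).
Proof.
move=> Cc; split=> [_ [c _ <-]|w Mw]; first exact: MK.
have [rw wn _] := nxP Mw.
have [k kE] := toK (A'D (ex_intro2 _ _ (nx w) rw erefl)).
have [c Cc' kc] := Cc k; exists (iota c); first by exists c.
by apply: le_trans (ltW wn) _; rewrite -kE -leK.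
Qed.

Let K_le_A : [set: K] #<= [set: set_type A].
Proof.
by apply: (@card_le_injI _ _ _ _ (nx \o iota)) => // x y _ _ /nx_iota_inj.
Qed.

Let A_le_K : [set: set_type A] #<= [set: K].
Proof.
rewrite card_le_setT_sub; apply: (card_le_trans (Amin (cofinalK _))); last exact: card_image_le.
by move=> k; exists k.
Qed.

Hypothesis no_countable : forall C, cofinal_in C -> ~ countable C.

(** [nx] maps the points of [K] below [k] injectively into the [R]-segment below [nx k], which is
    smaller than [A] since [R] is initial. Cofinal sets of [K] are cofinal in [M], hence at least as
    large as [A]. *)
Lemma thin_regular : go_regular_uncountable_cardinal K.
Proof.
split; first exact: Kwf.
split; last split.
- move=> k; split; first exact: card_leT.
  move=> Kk; have [rk kn _] := nxP (MK k); apply: (@Rini (nx (iota k))).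
  apply: (card_le_trans A_le_K); apply: (card_le_trans Kk).
  apply: (@card_le_injI _ _ _ _ (nx \o iota)); last by move=> x y _ _ /nx_iota_inj.
  move=> y /= yk; rewrite ltK in yk; have [ry _ _] := nxP (MK y).
  apply: (records_lt RW) => //.
  exact: le_lt_trans (nx_le (MK y) (DK k) yk) kn.
- move=> Kc; apply: (no_countable Acof); apply: card_le_trans Kc.
  by rewrite -card_le_setT_sub.
- move=> C /cofinalK/Amin AC; apply: (card_le_trans K_le_A).
  rewrite card_le_setT_sub; apply: (card_le_trans AC); exact: card_image_le.
Qed.

Lemma thin_embedding : embedding iota.
Proof.
split; first exact: iota_inj.
- move=> k U /order_nbhs_below[[w wk wU]|[kmin Uk]]; last first.
    apply: (filterS _ (wo_nbhs_le Kwf k)) => y /=; rewrite leK => yk.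
    by have -> // : iota y = iota k by apply/le_anti; rewrite yk kmin.
  have below (y : K) : (y < k)%O -> (forall z : K, (y < z)%O -> (z <= k)%O -> U (iota z)) ->
      nbhs k (iota @^-1` U).
    move=> yk yU; apply: (filterS _ (filterI (order_nbhs_gt yk) (wo_nbhs_le Kwf k))).
    by move=> z /= [yz zk]; exact: yU.
  (* [s] is the candidate left end: either a point of [D] between [w] and [k], or the start of a gap
     of [D] just below [k]. *)
  have [|s /= sD smin] := @wo_least _ _ Wwf
      [set s | (w <= s)%O /\ (s < iota k)%O /\ D s \/ (s < iota k)%O /\
               forall e, D e -> (s < e)%O -> (e < iota k)%O -> False].
    have [[e De [we ek]]|ne] := pselect (exists2 e, D e & (w <= e)%O /\ (e < iota k)%O).
      by exists e; left.
    by exists w; right; split => // e De we ek; apply: ne; exists e => //; split=> //; exact: ltW.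
  have [wss|[sk sP]] := sD.
    have [ws [sk /toK[y yE]]] := wss.
    apply: (below y); first by rewrite ltK yE.
    move=> z; rewrite ltK leK yE => sz zk; apply: wU => //; exact: le_lt_trans sz.
  have only (z : K) : (s < iota z)%O -> (z <= k)%O -> U (iota z).
    rewrite leK le_eqVlt => sz /orP[/eqP ->|zk]; first by apply: wU.
    by case: (sP _ (DK z) sz zk).
  have [/toK[y yE]|nDs] := pselect (D s).
    by apply: (below y) => [|z]; rewrite ltK yE //; exact: only.
  (* A point of [K] below [k] would, by minimality of [s], make [s] a limit of [D], hence a member.
     So [k] is the first point of [K]. *)
  have nlt (z : K) : ~ (z < k)%O.
    rewrite ltK => zk; have zs : (iota z < s)%O.
      rewrite ltNge; apply/negP; rewrite le_eqVlt => /orP[/eqP sz|sz].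
        by apply: nDs; rewrite sz; exact: DK.
      exact: sP (DK z) sz zk.
    apply: (nDs); apply: D_closed; first exact: Mdown (MK k) (ltW sk).
    split; first by exists (iota z).
    move=> j js; apply: contrapT => nj.
    suff /smin : (w <= j)%O /\ (j < iota k)%O /\ D j \/ (j < iota k)%O /\
        forall e, D e -> (j < e)%O -> (e < iota k)%O -> False by rewrite leNgt js.
    right; split; first exact: lt_trans sk.
    move=> e De je ek; have [es|se|es] := ltgtP e s.
    - by apply: nj; exists e.
    - exact: sP De se ek.
    - by apply: nDs; rewrite -es.
  apply: (filterS _ (wo_nbhs_le Kwf k)) => z /=; rewrite le_eqVlt => /orP[/eqP ->|/nlt //].
  exact: wU.
- move=> k V /order_nbhs_below[[w wk wV]|[kmin Vk]].
    rewrite ltK in wk.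
    exists [set z | (iota w < z)%O /\ (z <= iota k)%O].
      exact: (filterI (order_nbhs_gt wk) (wo_nbhs_le Wwf _)).
    by move=> y [wy yk]; apply: wV; rewrite ?ltK ?leK.
  exists [set z | (z <= iota k)%O]; first exact: wo_nbhs_le.
  by move=> y /=; rewrite -leK => yk; have -> // : y = k by apply/le_anti; rewrite yk kmin.
Qed.

(** The image of a club is cofinal in [M], so it has a limit in [X]; that limit lies in [D], and in
    the club by closedness. *)
Lemma thin_stationary (X : set W) :
  (forall C, cofinal_in C -> exists x, [/\ X x, M x & limit_of C x]) ->
  go_stationary (iota @^-1` X).
Proof.
move=> H E [Ecl /cofinalK /H[x [Xx Mx [[j jx] xl]]]].
have /toK[k kE] : D x.
  apply: D_closed => //; split; first by exists j.
  by move=> i /xl[_ [e _ <-] ei]; exists (iota e) => //; exact: DK.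
subst x; exists k; split => //; apply: Ecl => U /order_nbhs_below[[w wk wU]|[kmin _]].
  rewrite ltK in wk; have [_ [e Ee <-] [we ek]] := xl _ wk.
  by exists e; split => //; apply: wU; rewrite ?ltK ?leK // ltW.
have [_ [e Ee <-] [_ ek]] := xl _ jx.
by have := kmin e; rewrite leNgt ltK ek.
Qed.

Lemma thin_copy (X : set W) :
  (forall C, cofinal_in C -> exists x, [/\ X x, M x & limit_of C x]) ->
  exists (Y : set (set_type X)) (d' : Order.disp_t) (K : orderTopologicalType d') (S : set K),
    [/\ go_regular_uncountable_cardinal K, go_stationary S &
        go_homeomorphic (set_type Y) (set_type S)].
Proof.
move=> H; pose S : set K := iota @^-1` X.
pose e (s : set_type S) : set_type X := exist _ (iota (val s)) (mem_set (set_mem (valP s))).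
have eE : embedding e.
  apply: (embedding_factor (embedding_val X)).
  exact: (embedding_comp (embedding_val S) thin_embedding).
exists (range e), _, K, S; split; first exact: thin_regular.
  exact: thin_stationary.
exact/homeomorphic_sym/embedding_homeomorphic.
Qed.

End ThinCofinalSet.

(** * Construction of non-archimedean structures *)

Section Construction.
Variables (d : Order.disp_t) (W : orderTopologicalType d).
Hypothesis Wwf : go_well_ordered W.
Variable X : set W.
Local Notation T := (set_type X).
Hypothesis no_stationary : forall (Y : set T) (d' : Order.disp_t)
  (K : orderTopologicalType d') (S : set K),
  go_regular_uncountable_cardinal K -> go_stationary S ->
  ~ go_homeomorphic (set_type Y) (set_type S).

(** Otherwise a cofinal set of least cardinality thins out to a copy in [X] of a stationary set. Its
    uncountability holds because countable cofinal sets contain cofinal subsets without limits. *)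
Lemma cofinal_without_limits (M : set W) :
  (forall x y, M x -> (y <= x)%O -> M y) ->
  (forall x, M x -> exists2 y, M y & (x < y)%O) ->
  exists2 C, cofinal_in M C & forall x : T, M (val x) -> ~ limit_of C (val x).
Proof.
move=> Mdown Mnomax; apply: contrapT => nC.
have H C : cofinal_in M C -> exists x, [/\ X x, M x & limit_of C x].
  move=> CM; apply: contrapT => nx; apply: nC; exists C => // x Mx lx; apply: nx.
  by exists (val x); split => //; exact: set_mem (valP x).
have Mcof : cofinal_in M M by split => // w Mw; exists w.
have [m0 [_ Mm0 _]] := H _ Mcof.
have [|A Acof Amin] := @card_minimal W (cofinal_in M); first by exists M.
have [R RW Rini] := exists_initial_well_order (set_type A).
have ncount C : cofinal_in M C -> ~ countable C.
  move=> Cc /(countable_cofinal_no_limit Mnomax Cc)[B Bc Bl].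
  by have [x [_ Mx lx]] := H _ Bc; exact: Bl lx.
have [Y [d' [K [S [Kreg Sst YS]]]]] :=
  thin_copy Wwf Mdown Mnomax Acof Amin RW Rini Mm0 ncount H.
exact: no_stationary Kreg Sst YS.
Qed.

(** [rho w] is the least point at or above [w] of a cofinal set without limits in [X]. Just below a
    point of [X] there are no members of that set, so [rho] is locally constant. *)
Lemma cofinal_retraction (M : set W) :
  (forall x y, M x -> (y <= x)%O -> M y) ->
  (forall x, M x -> exists2 y, M y & (x < y)%O) ->
  exists rho : W -> W,
    [/\ (forall w, M w -> M (rho w) /\ (w <= rho w)%O),
        (forall v w, M w -> (v <= w)%O -> (rho v <= rho w)%O) &
        (forall x : T, M (val x) -> \forall y \near x, rho (val y) = rho (val x))].
Proof.
move=> Mdown Mnomax; have [C [CM Cc] Cl] := cofinal_without_limits Mdown Mnomax.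
have rP w : exists c, M w -> [/\ C c, (w <= c)%O & forall c', C c' -> (w <= c')%O -> (c <= c')%O].
  have [Mw|] := pselect (M w); last by exists w.
  have [|c [Cc' wc] cmin] := @wo_least _ _ Wwf (C `&` [set c | (w <= c)%O]).
    by have [c Cc' wc] := Cc _ Mw; exists c.
  by exists c => _; split => // c' Cc'' wc'; apply: cmin.
have /choice[rho {}rP] := rP.
exists rho; split.
- by move=> w /rP[/CM].
- move=> v w Mw vw; have [_ _ vmin] := rP _ (Mdown _ _ Mw vw).
  by have [Cw ww _] := rP _ Mw; apply: vmin => //; exact: le_trans ww.
- move=> x Mx; have [Cx xx xmin] := rP _ Mx.
  have [[j jx jC]|nj] := pselect (exists2 j, (j < val x)%O &
      forall e, C e -> (j < e)%O -> (e < val x)%O -> False); last first.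
    have nmin j : ~ (j < val x)%O.
      move=> jx; apply: (Cl x Mx); split; first by exists j.
      move=> i ix; apply: contrapT => Hi; apply: nj; exists i => // e Ce ie ex.
      by apply: Hi; exists e.
    apply/nbhs_set_type; exists [set z | (z <= val x)%O]; first exact: wo_nbhs_le.
    by move=> y /=; rewrite le_eqVlt => /orP[/eqP ->|/nmin].
  apply: (sub_nbhsI Wwf jx) => z jz zx.
  have [Cz zz zmin] := rP _ (Mdown _ _ Mx zx).
  apply/le_anti; rewrite zmin //=; last exact: le_trans xx.
  apply: xmin => //; rewrite leNgt; apply/negP => zx'.
  exact: jC Cz (lt_le_trans jz zz) zx'.
Qed.

Variables (I : Type) (R : I -> I -> Prop).
Hypothesis RW : strict_well_order R.
Variable i0 : I.

(** Each fibre of [rho] is open and bounded by its value, so it takes over the structure that exists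
    up to that value. *)
Lemma nonarchimedean_sum (M : set W) (rho : W -> W) :
  (forall w, M w -> M (rho w) /\ (w <= rho w)%O) ->
  (forall x : T, M (val x) -> \forall y \near x, rho (val y) = rho (val x)) ->
  (forall w, M w -> exists E, nonarchimedean [set x : T | (val x <= w)%O] R E) ->
  exists E, nonarchimedean [set x : T | M (val x)] R E.
Proof.
move=> rhoM rhoN H.
have H' w : exists E, M w -> nonarchimedean [set x : T | (val x <= w)%O] R E.
  have [/H[E HE]|] := pselect (M w); first by exists E.
  by exists (fun _ _ _ => True).
have /choice[F FP] := H'.
exists (fun i x y => [/\ M (val x), M (val y), rho (val x) = rho (val y) & F (rho (val x)) i x y]).
split; first split.
- move=> i x /= Mx; split => //; have [Mr xr] := rhoM _ Mx.
  by have [[Er _ _] _ _ _] := FP _ Mr; exact: Er.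
- move=> i x y [Mx My xy E]; split => //; have [Mr xr] := rhoM _ Mx.
  by rewrite -xy; have [[_ Es _] _ _ _] := FP _ Mr; exact: Es.
- move=> i x y z [Mx My xy E] [_ Mz yz E']; have [Mr xr] := rhoM _ Mx.
  split => //; first by rewrite xy.
  by have [[_ _ Et] _ _ _] := FP _ Mr; apply: Et E _; rewrite xy.
- move=> i j x y ij [Mx My xy E]; have [Mr xr] := rhoM _ Mx.
  by split => //; have [_ Em _ _] := FP _ Mr; exact: Em ij E.
- move=> i x /= Mx; have [Mr xr] := rhoM _ Mx; have [_ _ Eo _] := FP _ Mr.
  apply: (filterS _ (filterI (rhoN _ Mx) (Eo i x xr))) => y [yx Exy] My.
  by split => //; apply: Exy => /=; rewrite -yx; case: (rhoM _ My).
- move=> x U /= Mx Ux; have [Mr xr] := rhoM _ Mx; have [_ _ _ Eb] := FP _ Mr.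
  have [i iU] := Eb x U xr Ux; exists i => y My [_ _ xy E]; apply: iU => //=.
  by rewrite xy; case: (rhoM _ My).
Qed.

Lemma nbhs_sub_le (x : T) : nbhs x [set y : T | (val y <= val x)%O].
Proof. by apply/nbhs_set_type; exists [set z | (z <= val x)%O]; first exact: wo_nbhs_le. Qed.

(** A point at [w] becomes a class by itself at every index; [i0] is an index that isolates it. *)
Lemma nonarchimedean_isolated w E :
  nonarchimedean [set x : T | (val x < w)%O] R E ->
  (forall p : T, val p = w -> go_isolated p) ->
  exists E', nonarchimedean [set x : T | (val x <= w)%O] R E'.
Proof.
move=> [[Er Es Et] Em Eo Eb] wI.
exists (fun i x y => x = y \/ [/\ (val x < w)%O, (val y < w)%O & E i x y]); split; first split.
- by move=> i x _; left.
- by move=> i x y [->|[xw yw xy]]; [left|right; split => //; exact: Es].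
- move=> i x y z [->//|[xw yw xy]] [<-|[_ zw yz]]; right; split => //; exact: Et xy yz.
- by move=> i j x y ij [->|[xw yw xy]]; [left|right; split => //; exact: Em xy].
- move=> i x /=; rewrite le_eqVlt => /orP[/eqP xw|xw].
    by have /isolatedP := wI x xw; apply: filterS => y ->; left.
  apply: (filterS _ (filterI (Eo i x xw) (nbhs_sub_le x))) => y [xy yx] _; right.
  have yw : (val y < w)%O by exact: le_lt_trans xw.
  by split => //; exact: xy.
- move=> x U /=; rewrite le_eqVlt => /orP[/eqP xw|xw] Ux.
    exists i0 => y _ [<-|[]]; first exact: nbhs_singleton.
    by rewrite xw ltxx.
  have [i iU] := Eb x U xw Ux; exists i => y _ [<-|[_ yw xy]]; first exact: nbhs_singleton.
  exact: iU.
Qed.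

(* The class of [p] of index [i] is the tail [{p}] together with [{s > i}]; off the
   tail the old classes are kept, cut along the fibres of [s]. *)
Lemma nonarchimedean_nonisolated (p : T) E (s : T -> I) : ~ go_isolated p ->
  nonarchimedean [set x : T | (val x < val p)%O] R E ->
  (forall x : T, (val x < val p)%O -> \forall y \near x, s y = s x) ->
  (forall i, exists2 w, (w < val p)%O &
     forall x : T, (w < val x)%O -> (val x < val p)%O -> R i (s x)) ->
  (forall w, (w < val p)%O ->
     exists i, forall x : T, (val x < val p)%O -> R i (s x) -> (w < val x)%O) ->
  exists E', nonarchimedean [set x : T | (val x <= val p)%O] R E'.
Proof.
move=> pI [[Er Es Et] Em Eo Eb] sN slim sbound; have [Rtr Rtri Rwf] := RW.
pose tail i x := x = p \/ R i (s x).
have notp x : (val x <= val p)%O -> x <> p -> (val x < val p)%O.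
  by move=> xp nxp; rewrite lt_neqAle xp andbT; apply/eqP => /val_inj.
exists (fun i x y => tail i x /\ tail i y \/ [/\ ~ tail i x, ~ tail i y, s x = s y & E i x y]).
split; first split.
- move=> i x /= xp; have [tx|ntx] := pselect (tail i x); [by left|right; split => //].
  by apply: Er; apply: notp => // xp'; apply: ntx; left.
- by move=> i x y [[]|[tx ty sxy xy]]; [left|right; split => //; exact: Es].
- move=> i x y z [[tx ty]|[tx ty sxy xy]] [[ty' tz]|[ty' tz syz yz]] //; first by left.
  by right; split => //; [rewrite sxy|exact: Et xy yz].
- have tailS i j x : R i j -> tail j x -> tail i x.
    by move=> ij [->|jx]; [left|right; exact: Rtr jx].
  move=> i j x y ij [[tx ty]|[tx ty sxy xy]]; first by left; split; exact: tailS ij _.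
  (* Equal values of [s] bring both points into the larger tail together, which is why the old
     classes are cut along the fibres of [s]. *)
  have [ix|nix] := pselect (R i (s x)).
    by left; split; right => //; rewrite -sxy.
  right; split => //; last exact: Em xy.
    by move=> [xp|//]; apply: tx; left.
  by move=> [yp|]; [apply: ty; left|rewrite -sxy].
- move=> i x /= xp; have [xE|nxp] := pselect (x = p).
    subst x; have [w wp wt] := slim i.
    apply: (sub_nbhsI Wwf wp) => z wz zp _; left; split; first by left.
    by have [zE|/(notp _ zp) zp'] := pselect (z = p); [left|right; exact: wt].
  have {}xp := notp _ xp nxp.
  apply: (filterS _ (filterI (sN x xp) (filterI (Eo i x xp) (nbhs_sub_le x)))) => y [syx [xy yx]] _.
  have yp : (val y < val p)%O by exact: le_lt_trans xp.
  have nyp : y <> p by move=> yE; rewrite yE ltxx in yp.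
  have [ix|nix] := pselect (R i (s x)); first by left; split; right => //; rewrite syx.
  by right; split => //; [case|rewrite /tail syx; case|exact: xy].
- move=> x U /= xp Ux; have [xE|nxp] := pselect (x = p).
    subst x; have [w wp wU] := sub_nbhsE Wwf pI Ux; have [i iw] := sbound _ wp.
    exists i => y yp [[_ [->|iy]]|[ntp]]; first exact: nbhs_singleton.
      have [->|/(notp _ yp) yp'] := pselect (y = p); first exact: nbhs_singleton.
      by apply: wU => //; exact: iw.
    by exfalso; apply: ntp; left.
  have {}xp := notp _ xp nxp; have [i1 i1U] := Eb x U xp Ux.
  (* The larger of [s x] and [i1]: [x] is off the tail there, and the old class is small enough. *)
  have [i [nix ii1]] : exists i, ~ R i (s x) /\ (i = i1 \/ R i1 i).
    have [lt|E1|gt] := Rtri (s x) i1.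
    - exists i1; split; last by left.
      by move=> gt; exact: (wf_irrefl Rwf (Rtr _ _ _ lt gt)).
    - by exists i1; split; [rewrite E1; exact: wf_irrefl|left].
    - by exists (s x); split; [exact: wf_irrefl|right].
  exists i => y yp [[[//|//] _]|[_ nty sxy xy]]; apply: i1U => /=.
    by apply: notp => // yE; apply: nty; left.
  by case: ii1 => [<-//|/Em]; apply.
Qed.

(** A cofinal [I]-sequence below each non-isolated point, not necessarily increasing, whose initial
    parts are bounded. *)
Variable Icof : forall p : T, ~ go_isolated p ->
  exists g : I -> W,
  [/\ (forall i, (g i < val p)%O),
      (forall w, (w < val p)%O -> exists i, (w <= g i)%O) &
      (forall i, exists2 w, (w < val p)%O & forall j, R j i \/ j = i -> (g j < w)%O)].

Lemma nonarchimedean_down (M : set W) :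
  (forall x y, M x -> (y <= x)%O -> M y) ->
  (forall w, M w -> exists E, nonarchimedean [set x : T | (val x <= w)%O] R E) ->
  exists E, nonarchimedean [set x : T | M (val x)] R E.
Proof.
move=> Mdown H; have [[m Mm mmax]|nmax] := pselect (exists2 m, M m & forall x, M x -> (x <= m)%O).
  have [E HE] := H _ Mm; exists E.
  have -> // : [set x : T | M (val x)] = [set x : T | (val x <= m)%O].
  by apply/predeqP => x; split=> /= [/mmax//|xm]; exact: Mdown xm.
have Mnomax x : M x -> exists2 y, M y & (x < y)%O.
  move=> Mx; apply: contrapT => nx; apply: nmax; exists x => // y My.
  by rewrite leNgt; apply/negP => xy; apply: nx; exists y.
have [rho [rhoM _ rhoN]] := cofinal_retraction Mdown Mnomax.
exact: nonarchimedean_sum rhoM rhoN H.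
Qed.

Lemma nonarchimedean_le (w : W) : exists E, nonarchimedean [set x : T | (val x <= w)%O] R E.
Proof.
elim/(well_founded_ind Wwf): w => w IH.
have [Rtr Rtri Rwf] := RW.
have Mdown x y : (x < w)%O -> (y <= x)%O -> (y < w)%O by move=> xw yx; exact: le_lt_trans xw.
have [E HE] := @nonarchimedean_down [set v | (v < w)%O] Mdown IH.
have [wI|/existsNP[p /not_implyP[pw pI]]] := pselect (forall p : T, val p = w -> go_isolated p).
  exact: nonarchimedean_isolated HE wI.
subst w.
have Mnomax x : (x < val p)%O -> exists2 y, (y < val p)%O & (x < y)%O.
  by move=> xp; have [z xz zp] := nonisolated_between Wwf pI xp; exists (val z).
have [rho [rhoM rhomono rhoN]] := cofinal_retraction Mdown Mnomax.
have [g [gp gcof gini]] := Icof pI.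
(* [sig w] is the first index at which [g] reaches [w]. Composed with [rho] it is locally constant,
   and it exceeds any given index close to [p]. *)
have sigP w : exists i, (w < val p)%O -> (w <= g i)%O /\ forall j, R j i -> ~ (w <= g j)%O.
  have [wp|] := pselect (w < val p)%O; last by exists i0.
  have [|i wi imin] := @wf_least _ _ [set i | (w <= g i)%O] Rwf; first exact: gcof.
  by exists i.
have /choice[sig {}sigP] := sigP.
apply: (nonarchimedean_nonisolated (s := fun x => sig (rho (val x))) pI HE).
- by move=> x xp; apply: filterS (rhoN x xp) => y ->.
- move=> i; have [w wp wi] := gini i; exists w => // x wx xp.
  have [rp xr] := rhoM _ xp; have [rg _] := sigP _ rp.
  have H : ~ (R (sig (rho (val x))) i \/ sig (rho (val x)) = i).
    move=> /wi; apply/negP; rewrite -leNgt; exact: ltW (lt_le_trans wx (le_trans xr rg)).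
  by have [ri|ri|//] := Rtri (sig (rho (val x))) i; case: H; [left|right].
- move=> w wp; exists (sig (rho w)) => x xp iR.
  rewrite ltNge; apply/negP => xw.
  have [rp _] := rhoM _ xp; have [_ rmin] := sigP _ rp; apply: rmin iR _.
  have [rw _] := rhoM _ wp; have [rg _] := sigP _ rw.
  exact: le_trans (rhomono _ _ wp xw) rg.
Qed.

Lemma nonarchimedean_total : exists E, nonarchimedean [set: T] R E.
Proof.
have [//|w _|E HE] := @nonarchimedean_down setT; first exact: nonarchimedean_le.
by exists E.
Qed.

End Construction.

(** * The common character as P-number and index set *)

Section HomogeneousCharacter.
Variables (d : Order.disp_t) (W : orderTopologicalType d).
Hypothesis Wwf : go_well_ordered W.
Variable X : set W.
Local Notation T := (set_type X).
Variables (x0 : T) (B : set (set T)).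
Hypothesis x0I : ~ go_isolated x0.
Hypothesis Bbase : go_local_base x0 B.
Hypothesis Bmin : forall B', go_local_base x0 B' -> B #<= B'.
Hypothesis charE : forall p : T, ~ go_isolated p -> go_character_eq x0 p.

(** The intervals from [h j] to [p] form a local base at [p]; homogeneity carries its size over to
    [x0], where [B] is smallest. *)
Lemma cofinal_family_large (J : Type) (F : set J) (h : J -> W) (p : T) :
  ~ go_isolated p -> (forall j, F j -> (h j < val p)%O) ->
  (forall w, (w < val p)%O -> exists2 j, F j & (w <= h j)%O) -> B #<= F.
Proof.
move=> pI hp hcof.
have [|B' [B'base B'F]] :=
    (charE pI).1 [set [set a : T | (h j < val a)%O /\ (val a <= val p)%O] | j in F].
  split=> [_ [j Fj <-]|V /(sub_nbhsE Wwf pI)[w wp wV]].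
    split; last by split => //; exact: hp.
    rewrite openE => a /= [ha ap]; apply: (sub_nbhsI Wwf ha) => z hz za.
    by split => //; exact: le_trans ap.
  have [j Fj wj] := hcof _ wp.
  exists [set a : T | (h j < val a)%O /\ (val a <= val p)%O]; first by exists j.
  by move=> a [ha ap]; apply: wV => //; exact: le_lt_trans ha.
apply: (card_le_trans (Bmin B'base)); apply: (card_le_trans B'F); exact: card_image_le.
Qed.

(** At a non-isolated [p], fewer than [|B|] left ends are not cofinal, so one interval lies in all
    the open sets. Conversely the members of [B] intersect in [{x0}], which is not open. *)
Lemma Pnumber_character : go_Pnumber_is T (set_type B).
Proof.
have [Bo Bb] := Bbase.
split=> [Td|_]; first by case: x0I; exact: Td.
split.
- move=> F [FB nBF] Fo; rewrite openE => p pF.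
  have [/isolatedP pI|pI] := pselect (go_isolated p).
    by apply: (filterS _ pI) => _ ->.
  have hP (U : set T) : exists w, F U -> (w < val p)%O /\
      forall z : T, (w < val z)%O -> (val z <= val p)%O -> U z.
    have [FU|] := pselect (F U); last by exists (val p).
    have [|w wp wU] := @sub_nbhsE _ _ Wwf _ p U pI; last by exists w.
    by apply: open_nbhs_nbhs; split; [exact: Fo|exact: pF].
  have /choice[h {}hP] := hP.
  have [[w wp wF]|nw] := pselect (exists2 w, (w < val p)%O & forall U, F U -> (h U <= w)%O).
    apply: (sub_nbhsI Wwf wp) => z wz zp U FU; apply: (hP U FU).2 => //.
    exact: le_lt_trans (wF _ FU) wz.
  case: nBF; rewrite card_le_setT_sub; apply: (cofinal_family_large (h := h) pI).
    by move=> U /hP[].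
  move=> w wp; apply: contrapT => nU; apply: nw; exists w => // U FU.
  by rewrite leNgt; apply/negP => wU; apply: nU; exists U => //; exact: ltW.
- move=> J HJ; have [//|BJ] := card_le_total J (set_type B).
  apply: contrapT => nJB; apply: x0I; rewrite /go_isolated.
  have -> : [set x0] = \bigcap_(U in B) U.
    apply/predeqP => y; split=> [-> U /Bo[]//|yB].
    apply: contrapT => yx.
    have [|U /Bb[V BV VU] nUy] := @T1_sub _ _ X x0 y; first by move=> xy; apply: yx.
    by apply: nUy; apply: VU; exact: yB.
  apply: HJ => [|U /Bo[]//]; split; first by rewrite -card_le_setT_sub.
  by move=> JB; apply: nJB; rewrite (card_le_eqr (card_setT B)).
Qed.

(** [g i] is the left end of an interval inside the base set at [p] that corresponds to [i]. A
    proper initial segment is too small for its values to be cofinal, hence they are bounded. *)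
Lemma initial_cofinal (R : set_type B -> set_type B -> Prop) :
  (forall i, ~ ([set: set_type B] #<= [set j | R j i])) ->
  forall p : T, ~ go_isolated p -> exists g : set_type B -> W,
  [/\ (forall i, (g i < val p)%O),
      (forall w, (w < val p)%O -> exists i, (w <= g i)%O) &
      (forall i, exists2 w, (w < val p)%O & forall j, R j i \/ j = i -> (g j < w)%O)].
Proof.
move=> Rini p pI; have [Bp [[Bpo Bpb] BpB]] := (charE pI).2 _ Bbase.
have [f [fB finj]] := card_le_injE BpB.
have [q qp _] := nonisolated_nbhs_below Wwf pI (@filterT _ (nbhs p) _).
have gP (i : set_type B) : exists w, (w < val p)%O /\ forall b : set_type Bp, f b = val i ->
    forall z : T, (w < val z)%O -> (val z <= val p)%O -> val b z.
  have [[b fb]|nb] := pselect (exists b, f b = val i); last first.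
    (* Indices outside the range of [f] receive an arbitrary point below [p]. *)
    by exists (val q); split => // b fb; case: nb; exists b.
  have [ob bp] := Bpo _ (set_mem (valP b)).
  have [|w wp wb] := @sub_nbhsE _ _ Wwf _ p (val b) pI; first exact: open_nbhs_nbhs.
  by exists w; split => // c fc; have -> : c = b by apply: finj; rewrite fc fb.
have /choice[g {}gP] := gP.
have gp i : (g i < val p)%O by case: (gP i).
have gcof w : (w < val p)%O -> exists i, (w <= g i)%O.
  move=> wp; have [t wt tp] := nonisolated_between Wwf pI wp.
  have [|b Bpb' bt] := Bpb [set z : T | (val t < val z)%O].
    by apply: (sub_nbhsI Wwf tp) => z.
  pose b' : set_type Bp := exist _ b (mem_set Bpb').
  have [i iE] : exists i : set_type B, f b' = val i.
    by exists (exist (fun U => U \in B) (f b') (mem_set (fB b'))).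
  exists i; apply: (le_trans (ltW wt)); rewrite leNgt; apply/negP => gt.
  have [_ /(_ _ iE t gt (ltW tp)) /bt /=] := gP i.
  by rewrite ltxx.
exists g; split => // i.
have [w wp wi] : exists2 w, (w < val p)%O & forall j, R j i -> (g j < w)%O.
  apply: contrapT => nw; apply: (Rini i); rewrite card_le_setT_sub.
  apply: (cofinal_family_large (h := g) pI) => [j _ //|w wp].
  apply: contrapT => nj; apply: nw; exists w => // j ji.
  by rewrite ltNge; apply/negP => wj; apply: nj; exists j.
have mp : (Order.max w (g i) < val p)%O by rewrite gt_max wp gp.
have [t mt tp] := nonisolated_between Wwf pI mp.
move: mt; rewrite gt_max => /andP[wt gt]; exists (val t) => // j [ji|-> //].
exact: lt_trans (wi _ ji) wt.
Qed.

End HomogeneousCharacter.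

(** * The equivalence of the three conditions *)

Lemma homogeneous_discrete_clopen_base (d : Order.disp_t) (W : orderTopologicalType d) (X : set W) :
  go_well_ordered W ->
  (forall (Y : set (set_type X)) (d' : Order.disp_t)
            (K : orderTopologicalType d') (S : set K),
        go_regular_uncountable_cardinal K -> go_stationary S ->
        ~ go_homeomorphic (set_type Y) (set_type S)) ->
  (forall x y : set_type X, ~ go_isolated x -> ~ go_isolated y -> go_character_eq x y) ->
  exists I : Type, go_Pnumber_is (set_type X) I /\ go_discrete_clopen_base (set_type X) I.
Proof.
move=> Wwf nostat charE.
(* Without non-isolated points the space is discrete; its points serve as indices and each family is
   one singleton. *)
have [[x0 x0I]|niso] := pselect (exists x : set_type X, ~ go_isolated x); last first.
  have Td : go_discrete_space (set_type X).
    move=> A; rewrite openE => x Ax.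
    have /isolatedP xN : go_isolated x by apply: contrapT => xI; apply: niso; exists x.
    by apply: (filterS _ xN) => _ ->.
  exists (set_type X); split; first by split => // _; exact: card_eqxx.
  exists (fun x => [set [set x]]); split; last split; last split.
  - by move=> x y; exists setT; [exact: filterT|move=> _ _ -> ->].
  - move=> x _ ->; split; first exact: Td.
    by rewrite -[[set x]]setCK; apply: open_closedC; exact: Td.
  - by move=> _ [x _ ->]; exact: Td.
  - by move=> V _ x Vx; exists [set x]; [exists x|split => // _ ->].
have [|B Bbase Bmin] := @card_minimal _ (@go_local_base (set_type X) x0).
  exists [set U | open U /\ U x0]; split => // V.
  by rewrite nbhsE => -[U [oU Ux] UV]; exists U.
have [_ Bb] := Bbase.
have [|b0 Bb0 _] := Bb setT; first exact: filterT.
have {}charE p : ~ go_isolated p -> go_character_eq x0 p by exact: charE.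
exists (set_type B); split; first exact: (Pnumber_character Wwf x0I Bbase Bmin charE).
have [R RW Rini] := exists_initial_well_order (set_type B).
have [E HE] := nonarchimedean_total Wwf nostat RW (exist _ b0 (mem_set Bb0))
  (initial_cofinal Wwf Bbase Bmin charE Rini).
exact: nonarchimedean_discrete_clopen_base HE.
Qed.

Theorem theorem2p5 (d : Order.disp_t) (W : orderTopologicalType d) (X : set W) :
  go_well_ordered W ->
  let P1 :=
    (forall (Y : set (set_type X)) (d' : Order.disp_t)
            (K : orderTopologicalType d') (S : set K),
        go_regular_uncountable_cardinal K -> go_stationary S ->
        ~ go_homeomorphic (set_type Y) (set_type S)) /\
    (forall x y : set_type X, ~ go_isolated x -> ~ go_isolated y -> go_character_eq x y) in
  let P2 :=
    exists I : Type, go_Pnumber_is (set_type X) I /\ go_discrete_clopen_base (set_type X) I in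
  let P3 := forall n : nat, (0 < n)%N -> go_suborderable (go_power (set_type X) n) in
  (P1 <-> P2) /\ (P2 <-> P3).
Proof.
move=> Wwf P1 P2 P3.
have P12 : P1 -> P2 by move=> [nostat charE]; exact: homogeneous_discrete_clopen_base.
have P23 : P2 -> P3.
  move=> [I [TI TB]] n n0.
  exact: (discrete_clopen_base_power_suborderable (@T1_sub _ _ X) n0 TI TB).
have P31 : P3 -> P1.
  (* The square is completely normal, and both halves of (1) follow from that. *)
  move=> /(_ 2%N isT)/suborderable_completely_normal.
  move=> /(completely_normal_embedding embedding_pair_power) CN; split.
    by move=> Y d' K S; exact: completely_normal_square_not_stationary.
  by move=> x y xI yI; split; exact: completely_normal_character.
split; split; [exact: P12|by move=> /P23/P31|exact: P23|by move=> /P31/P12].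
Qed.
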